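(* Let $Y_1,\dots,Y_q$ be locally Lipschitz vector fields on $\mathbb{R}^n$ satisfying condition (H), and let $\Omega\subset\mathbb{R}^n$ be bounded. Then there is $C>0$ such that for every $x\in\Omega$, every subunit path $\gamma:[0,T]\to\mathbb{R}^n$ with $\gamma(0)=x$, and every $p\in\{1,\dots,\min\{q,n\}\}$, $$|\Lambda_p(\gamma(t))-\Lambda_p(x)|\le|\Lambda_p(x)|(e^{Ct}-1)\quad\text{for all }t\in[0,\min\{T,C^{-1}\}].$$ In particular, for every $I\in\mathcal{I}(p,q)$, $$|Y_I(\gamma(t))-Y_I(x)|\le C|\Lambda_p(x)|(e^{Ct}-1)\quad\text{for all }t\in[0,\min\{T,C^{-1}\}].$$
   Context: $Y_j=\sum_\alpha g_j^\alpha\partial_\alpha$ with $g_j$ locally Lipschitz. Condition (H): for every bounded open $\Omega'$ there is $C_{\Omega'}$ with $(Y_jg_k(x)-Y_kg_j(x))\cdot\nabla\in\{\sum_i c_iY_i(x):|c|\le C_{\Omega'}\}$ for a.e. $x\in\Omega'$, all $j,k$ (with $Y_jg_k=Dg_k\,g_j$, a.e.). Subunit path: Lipschitz $\gamma$ with $\dot\gamma=\sum_ju_j(t)Y_j(\gamma)$ a.e., $|u(t)|\le1$ a.e. For $1\le p\le\mu$, $\mathcal{I}(p,\mu):=\{(i_1,\dots,i_p):1\le i_1<\dots<i_p\le\mu\}$. For $I\in\mathcal{I}(p,q)$, $Y_I(x):=Y_{i_1}(x)\wedge\cdots\wedge Y_{i_p}(x)\in\bigwedge_p\mathbb{R}^n$,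 and for $K\in\mathcal{I}(p,n)$, $Y_I^K(x):=\det\big(g_{i_b}^{k_a}(x)\big)_{a,b=1}^p$, so that $Y_I=\sum_K Y_I^Ke_K$ with $\{e_K=e_{k_1}\wedge\dots\wedge e_{k_p}\}$ orthonormal and $|Y_I|^2=\sum_K(Y_I^K)^2$. $\Lambda_p(x):=(Y_J^K(x))_{J\in\mathcal{I}(p,q),K\in\mathcal{I}(p,n)}$ with Euclidean norm $|\Lambda_p(x)|^2=\sum_{J,K}Y_J^K(x)^2$. *)

(* Defs.v *)
From mathcomp Require Import all_boot all_fingroup.
From Stdlib Require Import Reals.
Set Implicit Arguments. Unset Strict Implicit. Unset Printing Implicit Defensive.
Local Open Scope R_scope.

Definition norm2 {n : nat} (x : 'I_n -> R) : R :=
  sqrt (\big[Rplus/0]_(i < n) (x i ^ 2)).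

Definition vsub {n : nat} (x y : 'I_n -> R) : 'I_n -> R := fun i => x i - y i.

Definition null_set (n : nat) (N : ('I_n -> R) -> Prop) : Prop :=
  forall eps, 0 < eps -> exists a b : nat -> 'I_n -> R,
    (forall k i, a k i <= b k i) /\
    (forall x, N x -> exists k, forall i, a k i <= x i <= b k i) /\
    (forall m, \big[Rplus/0]_(k < m) \big[Rmult/1]_(i < n) (b k i - a k i) < eps).

Definition null1 (N : R -> Prop) : Prop := null_set (fun v : 'I_1 -> R => N (v ord0)).

Definition is_bounded {n : nat} (Om : ('I_n -> R) -> Prop) : Prop :=
  exists M, forall x, Om x -> norm2 x <= M.

Definition is_open {n : nat} (Om : ('I_n -> R) -> Prop) : Prop :=
  forall x, Om x -> exists r, 0 < r /\ forall y, norm2 (vsub y x) < r -> Om y.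

Definition loc_lip {n : nat} (f : ('I_n -> R) -> ('I_n -> R)) : Prop :=
  forall x0, exists r L, 0 < r /\
    forall y z, norm2 (vsub y x0) < r -> norm2 (vsub z x0) < r ->
      norm2 (vsub (f y) (f z)) <= L * norm2 (vsub y z).

Definition frechet {n : nat} (f : ('I_n -> R) -> ('I_n -> R)) (x : 'I_n -> R)
  (D : 'I_n -> 'I_n -> R) : Prop :=
  forall eps, 0 < eps -> exists delta, 0 < delta /\
    forall y, norm2 (vsub y x) < delta ->
      norm2 (fun a => f y a - f x a - \big[Rplus/0]_(b < n) (D a b * (y b - x b)))
        <= eps * norm2 (vsub y x).

(* Condition (H).  Y_j = sum_a g j a d_a ; Y_j g_k = (Dg_k) g_j (a.e.). *)
Definition condH {q n : nat} (g : 'I_q -> ('I_n -> R) -> ('I_n -> R)) : Prop :=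
  forall Om : ('I_n -> R) -> Prop, is_open Om -> is_bounded Om ->
  exists C : R, null_set (fun x => Om x /\ ~ (forall j k : 'I_q,
      exists Dj Dk, frechet (g j) x Dj /\ frechet (g k) x Dk /\
      exists c : 'I_q -> R, norm2 c <= C /\
        forall a : 'I_n,
          \big[Rplus/0]_(b < n) (Dk a b * g j x b - Dj a b * g k x b)
          = \big[Rplus/0]_(i < q) (c i * g i x a))).

Definition subunit {q n : nat} (g : 'I_q -> ('I_n -> R) -> ('I_n -> R))
  (T : R) (gam : R -> 'I_n -> R) : Prop :=
  (exists L, forall s t, 0 <= s <= T -> 0 <= t <= T ->
      norm2 (vsub (gam s) (gam t)) <= L * Rabs (s - t)) /\
  null1 (fun t => 0 <= t <= T /\ ~ exists u : 'I_q -> R, norm2 u <= 1 /\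
      forall a : 'I_n, derivable_pt_lim (fun s => gam s a) t
                         (\big[Rplus/0]_(j < q) (u j * g j (gam t) a))).

Definition incr_idx {p m : nat} (I : p.-tuple 'I_m) : bool :=
  sorted (fun a b : 'I_m => ltn a b) I.

Definition detR {p : nat} (A : 'I_p -> 'I_p -> R) : R :=
  \big[Rplus/0]_(s : 'S_p)
     ((if odd_perm s then -1 else 1) * \big[Rmult/1]_(a < p) A a (s a)).

Definition YIK {q n p : nat} (g : 'I_q -> ('I_n -> R) -> ('I_n -> R))
  (I : p.-tuple 'I_q) (K : p.-tuple 'I_n) (x : 'I_n -> R) : R :=
  detR (fun a b : 'I_p => g (tnth I b) x (tnth K a)).

Definition LamNorm {q n : nat} (g : 'I_q -> ('I_n -> R) -> ('I_n -> R)) (p : nat)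
  (x : 'I_n -> R) : R :=
  sqrt (\big[Rplus/0]_(J : p.-tuple 'I_q | incr_idx J)
          \big[Rplus/0]_(K : p.-tuple 'I_n | incr_idx K) (YIK g J K x ^ 2)).

Definition LamDiff {q n : nat} (g : 'I_q -> ('I_n -> R) -> ('I_n -> R)) (p : nat)
  (y x : 'I_n -> R) : R :=
  sqrt (\big[Rplus/0]_(J : p.-tuple 'I_q | incr_idx J)
          \big[Rplus/0]_(K : p.-tuple 'I_n | incr_idx K)
             ((YIK g J K y - YIK g J K x) ^ 2)).

(* |Y_I(y) - Y_I(x)| in the orthonormal basis e_K of Lambda_p R^n *)
Definition YIDiff {q n p : nat} (g : 'I_q -> ('I_n -> R) -> ('I_n -> R))
  (I : p.-tuple 'I_q) (y x : 'I_n -> R) : R :=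
  sqrt (\big[Rplus/0]_(K : p.-tuple 'I_n | incr_idx K)
          ((YIK g I K y - YIK g I K x) ^ 2)).

(* Main.v *)
From HB Require Import structures.
From Coquelicot Require Import Coquelicot.
Require Import Defs.
From mathcomp Require Import all_boot all_fingroup.
From Stdlib Require Import Reals.
From Stdlib Require Import Lra Classical ClassicalEpsilon FunctionalExtensionality.
Set Implicit Arguments. Unset Strict Implicit. Unset Printing Implicit Defensive.
Local Open Scope R_scope.

(** At a point where (H) holds, the derivative of a minor [Y_J^K] along [Y_j] replaces one
    column [g_k] by [Dg_k g_j = Dg_j g_k + sum_i c_i g_i]; the first summand can be moved to
    the rows, so every term is again a minor, and the derivative is at most [C |Lambda_p|].
    A subunit path may however run entirely inside the null set where (H) fails.  We therefore
    translate it by a small vector [y]: covering the null set by boxes of small total volume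
    and averaging over [y], one coordinate at a time, some translate spends arbitrarily little
    time in the boxes.  Along that translate the derivative bound holds up to [O(|y|)] outside
    a set of times of small measure, on which Lipschitz continuity suffices; this gives
    Gronwall's inequality with a small error, and then [y] tends to [0]. *)

(** The averaging uses no measure theory. Indicators of boxes are replaced by products of the
    kernels [bump], whose primitive is a multiple of the arctangent: integrating one of them over a
    coordinate of the translate costs at most 2 PI times the radius, wherever the path is, and
    exchanging the two integrals becomes differentiation under the integral sign. Each of the n
    averages over [0, kappa] costs a factor 2 PI / kappa, so the volume of the cover is chosen after
    kappa. The time spent in the infinitely many boxes is recorded by a nondecreasing function [m]
    of small total increase whose right slope is at least 1 at every bad time. Gronwall's inequality
    then follows by real induction, [m] paying for the bad times. The same device handles the times
    at which the path has no subunit derivative. A subunit path comes with an arbitrary Lipschitz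
    constant. It enters only terms that vanish in the limit, so the final constant does not depend
    on the path. *)

HB.instance Definition _ := Monoid.isComLaw.Build R 0 Rplus
  (fun x y z => esym (Rplus_assoc x y z)) Rplus_comm Rplus_0_l.
HB.instance Definition _ := Monoid.isComLaw.Build R 1 Rmult
  (fun x y z => esym (Rmult_assoc x y z)) Rmult_comm Rmult_1_l.
HB.instance Definition _ := Monoid.isMulLaw.Build R 0 Rmult Rmult_0_l Rmult_0_r.
HB.instance Definition _ := Monoid.isAddLaw.Build R Rmult Rplus
  Rmult_plus_distr_r Rmult_plus_distr_l.

(** * Finite sums and Euclidean norms *)

Lemma functional_choice (A B : Type) (P : A -> B -> Prop) :
  (forall x, exists y, P x y) -> exists f, forall x, P x (f x).
Proof.
move=> H; exists (fun x => proj1_sig (constructive_indefinite_description _ (H x))) => x.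
exact: proj2_sig.
Qed.
Arguments functional_choice {A B} P.

Section BigR.
Variables (I : Type) (r : seq I) (P : pred I).

Lemma sumR_ge0 (F : I -> R) : (forall i, P i -> 0 <= F i) ->
  0 <= \big[Rplus/0]_(i <- r | P i) F i.
Proof. by move=> H; elim/big_ind: _ => //; [lra | move=> x y; lra]. Qed.

Lemma sumR_le (F G : I -> R) : (forall i, P i -> F i <= G i) ->
  \big[Rplus/0]_(i <- r | P i) F i <= \big[Rplus/0]_(i <- r | P i) G i.
Proof. by move=> H; elim/big_ind2: _ => // *; lra. Qed.

Lemma sumR_abs (F : I -> R) :
  Rabs (\big[Rplus/0]_(i <- r | P i) F i) <= \big[Rplus/0]_(i <- r | P i) Rabs (F i).
Proof.
elim/big_ind2: _ => [|x1 x2 y1 y2 H1 H2|i _]; [rewrite Rabs_R0; lra| |lra].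
have := Rabs_triang x2 y2; lra.
Qed.

Lemma sumR_sub (F G : I -> R) :
  \big[Rplus/0]_(i <- r | P i) F i - \big[Rplus/0]_(i <- r | P i) G i =
  \big[Rplus/0]_(i <- r | P i) (F i - G i).
Proof. by elim/big_rec3: _ => [|i x y z _ <-]; lra. Qed.

Lemma prodR_ge0 (F : I -> R) : (forall i, P i -> 0 <= F i) ->
  0 <= \big[Rmult/1]_(i <- r | P i) F i.
Proof. by move=> H; elim/big_ind: _ => //; [lra | exact: Rmult_le_pos]. Qed.
End BigR.

Lemma sumR_le_card (I : finType) (P : pred I) (F : I -> R) (c : R) :
  0 <= c -> (forall i, P i -> F i <= c) ->
  \big[Rplus/0]_(i | P i) F i <= INR #|I| * c.
Proof.
move=> c0 H; apply: (@Rle_trans _ (\big[Rplus/0]_(i : I) c)).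
  by rewrite big_mkcond; apply: sumR_le => i _; case: ifP => [/H|]; lra.
rewrite big_const; elim: #|I| => [|m IH]; first by rewrite /=; lra.
by rewrite iterS S_INR; lra.
Qed.

Lemma sumR_term (I : finType) (P : pred I) (F : I -> R) (i : I) :
  (forall j, P j -> 0 <= F j) -> P i -> F i <= \big[Rplus/0]_(j | P j) F j.
Proof.
move=> H Pi; rewrite (bigD1 i) //=.
have : 0 <= \big[Rplus/0]_(j | P j && (j != i)) F j.
  by apply: sumR_ge0 => j /andP[/H].
lra.
Qed.

Section L2.
Variables (I : finType) (P : pred I).

Definition l2 (f : I -> R) : R := sqrt (\big[Rplus/0]_(i | P i) (f i ^ 2)).

Lemma sumR_sqr_ge0 (f : I -> R) : 0 <= \big[Rplus/0]_(i | P i) (f i ^ 2).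
Proof. by apply: sumR_ge0 => i _; nra. Qed.

Lemma l2_ge0 f : 0 <= l2 f.
Proof. exact: sqrt_pos. Qed.

Lemma l2_sqr f : l2 f ^ 2 = \big[Rplus/0]_(i | P i) (f i ^ 2).
Proof. by rewrite pow2_sqrt //; exact: sumR_sqr_ge0. Qed.

Lemma l2_ext f h : (forall i, P i -> f i = h i) -> l2 f = l2 h.
Proof. by move=> H; rewrite /l2; congr sqrt; apply: eq_bigr => i /H ->. Qed.

Lemma l2_coord f i : P i -> Rabs (f i) <= l2 f.
Proof.
move=> Pi; rewrite -sqrt_Rsqr_abs; apply: sqrt_le_1_alt.
rewrite /Rsqr; have := @sumR_term I P (fun i => f i ^ 2) i (fun j _ => pow2_ge_0 _) Pi.
by rewrite /=; lra.
Qed.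

(* Cauchy-Schwarz from the nonnegativity of [sum (a f + b h)^2]. *)
Lemma l2_dot f h : \big[Rplus/0]_(i | P i) (f i * h i) <= l2 f * l2 h.
Proof.
set D := \big[_/_]_(i | _) _.
have key a b : 0 <= a ^ 2 * l2 f ^ 2 + 2 * a * b * D + b ^ 2 * l2 h ^ 2.
  rewrite !l2_sqr /D !big_distrr /= -!big_split /=; apply: sumR_ge0 => i _.
  have := pow2_ge_0 (a * f i + b * h i); nra.
have pf := l2_ge0 f; have ph := l2_ge0 h.
have := key (l2 h) (- l2 f); have := key (l2 h + 1) (- l2 f - 1).
case: (Req_dec (l2 f * l2 h) 0) => [fh0|fh0] _ H; last by have : 0 < l2 f * l2 h; nra.
rewrite fh0; case: (Rle_lt_dec D 0) => // D0.
(* If one norm vanishes and [D > 0], the coefficient of the null vector is tuned so that the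
   nonnegative quadratic form equals minus the other squared norm minus 2. *)
case/Rmult_integral: fh0 => [f0|h0].
  by have := key (- (l2 h ^ 2 + 1) / D) 1; rewrite f0; move=> K; exfalso; apply: (Rle_not_lt _ _ K);
  replace (_ + _) with (- l2 h ^ 2 - 2) by (field; lra); nra.
by have := key 1 (- (l2 f ^ 2 + 1) / D); rewrite h0; move=> K; exfalso; apply: (Rle_not_lt _ _ K);
  replace (_ + _) with (- l2 f ^ 2 - 2) by (field; lra); nra.
Qed.

Lemma l2_triang f h : l2 (fun i => f i + h i) <= l2 f + l2 h.
Proof.
have pf := l2_ge0 f; have ph := l2_ge0 h.
apply: Rsqr_incr_0_var; last lra.
have E : l2 (fun i => f i + h i) ^ 2 =
    l2 f ^ 2 + 2 * \big[Rplus/0]_(i | P i) (f i * h i) + l2 h ^ 2.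
  rewrite !l2_sqr big_distrr /= -!big_split /=; apply: eq_bigr => i _; ring.
have := l2_dot f h; rewrite !Rsqr_pow2 E; nra.
Qed.

(** Only finiteness of the constant matters later, so the square root of the cardinal is replaced by
    the cardinal, using N <= N^2 for natural N. *)
Lemma l2_le_card f c : 0 <= c -> (forall i, P i -> Rabs (f i) <= c) ->
  l2 f <= INR #|I| * c.
Proof.
move=> c0 H; apply: Rsqr_incr_0_var; last by apply: Rmult_le_pos => //; exact: pos_INR.
rewrite !Rsqr_pow2 l2_sqr.
apply: (@Rle_trans _ (INR #|I| * c ^ 2)).
  apply: sumR_le_card => [|i /H Hi]; first nra.
  by rewrite -(pow2_abs (f i)); apply: pow_incr; split=> //; exact: Rabs_pos.
case: #|I| => [|m]; first by rewrite /=; lra.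
have : 1 <= INR m.+1 by rewrite S_INR; have := pos_INR m; lra.
nra.
Qed.

Lemma l2_opp f : l2 (fun i => - f i) = l2 f.
Proof. by rewrite /l2; congr sqrt; apply: eq_bigr => i _; ring. Qed.
End L2.

Lemma norm2E n (x : 'I_n -> R) : norm2 x = l2 xpredT x.
Proof. by []. Qed.

Lemma norm2_coord n (x : 'I_n -> R) i : Rabs (x i) <= norm2 x.
Proof. exact: (l2_coord (P := xpredT)). Qed.

Lemma norm2_ge0 n (x : 'I_n -> R) : 0 <= norm2 x.
Proof. exact: sqrt_pos. Qed.

Lemma norm2_le_coord n (x : 'I_n -> R) c : 0 <= c -> (forall i, Rabs (x i) <= c) ->
  norm2 x <= INR n * c.
Proof. by move=> c0 H; have := @l2_le_card _ xpredT x c c0 (fun i _ => H i); rewrite card_ord. Qed.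

Lemma norm2_triang n (x y z : 'I_n -> R) :
  norm2 (vsub x z) <= norm2 (vsub x y) + norm2 (vsub y z).
Proof.
apply: Rle_trans (l2_triang xpredT _ _); apply: Req_le.
by apply: l2_ext => i _; rewrite /vsub; ring.
Qed.

Lemma norm2_sub_le n (x y : 'I_n -> R) : norm2 x <= norm2 (vsub x y) + norm2 y.
Proof.
apply: Rle_trans (l2_triang xpredT _ _); apply: Req_le.
by apply: l2_ext => i _; rewrite /vsub; ring.
Qed.

Lemma norm2_vsubxx n (x : 'I_n -> R) : norm2 (vsub x x) = 0.
Proof.
rewrite norm2E /l2 big1 ?sqrt_0 // => i _; rewrite /vsub; ring.
Qed.

(** * Norms of the vectors of minors *)

Section LambdaNorms.
Variables (q n : nat) (g : 'I_q -> ('I_n -> R) -> ('I_n -> R)) (p : nat).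

Definition incr_pair (JK : p.-tuple 'I_q * p.-tuple 'I_n) : bool :=
  incr_idx JK.1 && incr_idx JK.2.

Lemma LamNormE x : LamNorm g p x = l2 incr_pair (fun JK => YIK g JK.1 JK.2 x).
Proof. by rewrite /LamNorm /l2 pair_big. Qed.

Lemma LamDiffE y x :
  LamDiff g p y x = l2 incr_pair (fun JK => YIK g JK.1 JK.2 y - YIK g JK.1 JK.2 x).
Proof. by rewrite /LamDiff /l2 pair_big. Qed.

Lemma LamDiff_ge0 y x : 0 <= LamDiff g p y x.
Proof. exact: sqrt_pos. Qed.

Lemma LamNorm_ge0 x : 0 <= LamNorm g p x.
Proof. exact: sqrt_pos. Qed.

Lemma LamDiff_triang x y z : LamDiff g p x z <= LamDiff g p x y + LamDiff g p y z.
Proof.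
rewrite !LamDiffE; apply: Rle_trans (l2_triang _ _ _); apply: Req_le.
by apply: l2_ext => i _; ring.
Qed.

Lemma LamDiffC x y : LamDiff g p x y = LamDiff g p y x.
Proof. by rewrite !LamDiffE -l2_opp; apply: l2_ext => i _; ring. Qed.

Lemma LamNorm_le x y : LamNorm g p y <= LamDiff g p y x + LamNorm g p x.
Proof.
rewrite LamDiffE !LamNormE; apply: Rle_trans (l2_triang _ _ _); apply: Req_le.
by apply: l2_ext => i _; ring.
Qed.

Lemma YIDiff_le_LamDiff (I : p.-tuple 'I_q) y x : incr_idx I ->
  YIDiff g I y x <= LamDiff g p y x.
Proof.
move=> HI; apply: sqrt_le_1_alt.
apply: (@sumR_term _ (fun J : p.-tuple 'I_q => incr_idx J) (fun J => \big[Rplus/0]_(K : p.-tuple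
  'I_n | incr_idx K)
             ((YIK g J K y - YIK g J K x) ^ 2)) I) => // J _.
exact: sumR_sqr_ge0.
Qed.
End LambdaNorms.

(** * Growth and compactness on an interval *)

(** Real induction: the supremum of the times up to which the estimate from 0 holds is attained and
    cannot be smaller than [T]. Only [w] has to be continuous; monotonicity of [m] suffices to reach
    the supremum from the left, so [m] may jump. *)
Lemma right_local_growth (w m : R -> R) (T : R) : 0 <= T ->
  (forall t, 0 <= t <= T -> forall eps, 0 < eps -> exists d, 0 < d /\
     forall s, 0 <= s <= T -> Rabs (s - t) < d -> Rabs (w s - w t) < eps) ->
  (forall t s, 0 <= t -> t <= s -> s <= T -> m t <= m s) ->
  (forall t, 0 <= t < T -> exists d, 0 < d /\
     forall s, t < s < t + d -> s <= T -> w s - w t <= m s - m t) ->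
  w T - w 0 <= m T - m 0.
Proof.
move=> T0 wc mm loc.
pose E t := 0 <= t <= T /\ w t - w 0 <= m t - m 0.
have E0 : E 0 by split; lra.
have [tau [ub lub]] : {l | is_lub E l}.
  apply: completeness; [exists T => t []; lra | by exists 0].
have tau0 : 0 <= tau by apply: ub.
have tauT : tau <= T by apply: lub => t []; lra.
have Etau : E tau.
  split=> //; apply: Rle_plus_epsilon => e e0.
  have [d [d0 H]] := wc tau (conj tau0 tauT) e e0.
  have [t [Et tt]] : exists t, E t /\ tau - d < t.
    apply: NNPP => N; have : tau <= tau - d; last lra.
    apply: lub => t Et; apply: Rnot_lt_le => lt; apply: N; by exists t.
  have tle := ub _ Et; case: Et => t0T Et.
  have := H t t0T; rewrite Rabs_left1; last lra.
  move=> /(_ ltac:(lra)) /Rabs_def2 [].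
  by have := mm t tau ltac:(lra) ltac:(lra) ltac:(lra); lra.
case: (Rle_lt_or_eq_dec _ _ tauT) => [lt|<-]; last by case: Etau.
have [d [d0 H]] := loc tau (conj tau0 lt).
pose s := Rmin T (tau + d / 2).
have s1 : tau < s by apply: Rmin_glb_lt; lra.
have s2 : s <= T by apply: Rmin_l.
have s3 : s <= tau + d / 2 by apply: Rmin_r.
suff : s <= tau by lra.
by apply: ub; split; [lra | have := H s ltac:(lra) s2; case: Etau; lra].
Qed.

Lemma compact_gauge (a b : R) (delta : R -> R) : (forall t, 0 < delta t) ->
  exists d, 0 < d /\ forall x, a <= x <= b ->
    exists t, a <= t <= b /\ Rabs (x - t) < delta t /\ d <= delta t.
Proof.
move=> H; have [d Hd] := compactness_value_1d a b (fun t => mkposreal _ (H t)).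
by exists d; split; [exact: cond_pos | move=> x /Hd /NNPP].
Qed.

Definition upd n (x : 'I_n -> R) (i : 'I_n) (v : R) : 'I_n -> R :=
  fun l => if l == i then v else x l.

(* Tube-lemma induction: the coordinates in [r] are released one at a time. *)
Lemma locally_bounded_on_cube n (B : ('I_n -> R) -> R -> Prop) (M : R) :
  (forall x K K', K <= K' -> B x K -> B x K') ->
  (forall t, exists d K, 0 < d /\ forall x, (forall i, Rabs (x i - t i) < d) -> B x K) ->
  exists K, forall x, (forall i, Rabs (x i) <= M) -> B x K.
Proof.
move=> mono loc.
suff main (r : seq 'I_n) (t : 'I_n -> R) : exists d K, 0 < d /\ forall x,
    (forall i, i \in r -> Rabs (x i) <= M) ->
    (forall i, i \notin r -> Rabs (x i - t i) < d) -> B x K.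
  have [d [K [_ H]]] := main (enum 'I_n) (fun _ => 0).
  by exists K => x Hx; apply: H => i; rewrite ?mem_enum.
elim: r t => [|l r IH] t.
  by have [d [K [d0 H]]] := loc t; exists d, K; split=> // x _ Hx; apply: H => i; apply: Hx.
pose good v (dK : R * R) := 0 < dK.1 /\ forall x,
    (forall i, i \in r -> Rabs (x i) <= M) ->
    (forall i, i \notin r -> Rabs (x i - upd t l v i) < dK.1) -> B x dK.2.
have [f Hf] : exists f, forall v, good v (f v).
  apply: functional_choice => v.
  by have [d [K H]] := IH (upd t l v); exists (d, K).
(* The second entry makes [/ d] a common upper bound for the local constants [(f v).2]. *)
pose delta v := Rmin (f v).1 (/ (1 + Rabs (f v).2)).
have inv0 v : 0 < 1 + Rabs (f v).2 by have := Rabs_pos (f v).2; lra.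
have delta0 v : 0 < delta v.
  by apply: Rmin_glb_lt; [case: (Hf v) | apply: Rinv_0_lt_compat].
have [d [d0 Hd]] := compact_gauge (- M) M delta0.
exists d, (/ d); split=> // x Hr Ht.
have [v [_ [xv dv]]] := Hd (x l) (proj1 (Rabs_le_between _ _) (Hr l (mem_head _ _))).
have dv1 : d <= (f v).1 by apply: Rle_trans dv _; exact: Rmin_l.
have dv2 : d <= / (1 + Rabs (f v).2) by apply: Rle_trans dv _; exact: Rmin_r.
have {}xv : Rabs (x l - v) < (f v).1 by apply: Rlt_le_trans xv _; exact: Rmin_l.
apply: (mono _ (f v).2).
  have := Rle_abs (f v).2; have := Rinv_le_contravar _ _ d0 dv2.
  by rewrite Rinv_inv; lra.
apply: (proj2 (Hf v)) => i Hi; first by apply: Hr; rewrite in_cons Hi orbT.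
rewrite /upd; case: eqP => [->//|/eqP il].
by apply: Rlt_le_trans dv1; apply: Ht; rewrite in_cons negb_or il.
Qed.

Lemma sumR_mono_nat (F : nat -> R) (m m' : nat) : (forall k, 0 <= F k) -> leq m m' ->
  \big[Rplus/0]_(k < m) F k <= \big[Rplus/0]_(k < m') F k.
Proof.
move=> H; elim: m' => [|m' IH]; first by rewrite leqn0 => /eqP ->; lra.
rewrite leq_eqVlt => /orP [/eqP ->|]; first lra.
by rewrite ltnS => /IH; rewrite big_ord_recr /=; have := H m'; lra.
Qed.

(* MVT locates, for each [m], a point where the [m]-th partial sum is at most average;
   compactness makes it independent of [m]. *)
Lemma exists_average_point (G lam : nat -> R -> R) (c d E : R) : c < d ->
  (forall k x, is_derive (G k) x (lam k x)) ->
  (forall k x, continuity_pt (lam k) x) ->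
  (forall k x, 0 <= lam k x) ->
  (forall m, \big[Rplus/0]_(k < m) (G k d - G k c) <= E * (d - c)) ->
  exists y, c <= y <= d /\ forall m, \big[Rplus/0]_(k < m) lam k y <= E.
Proof.
move=> cd dG cl l0 HE; apply: NNPP => N.
pose S m y := \big[Rplus/0]_(k < m) lam k y.
have cS m y : continuity_pt (S m) y.
  apply: (continuity_pt_ext (fun y => \big[Rplus/0]_(k < m) lam k y)) => //.
  elim: m => [|m IH].
    by apply: (continuity_pt_ext (fun _ => 0)) => [z|];
      [rewrite big_ord0 | exact: continuity_pt_const].
  apply: (continuity_pt_ext (fun z => \big[Rplus/0]_(k < m) lam k z + lam m z)) => [z|].
    by rewrite big_ord_recr.
  exact: continuity_pt_plus.
pose good y (em : R * nat) := 0 < em.1 /\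
    (c <= y <= d -> forall z, Rabs (z - y) < em.1 -> E < S em.2 z).
have [f Hf] : exists f, forall y, good y (f y).
  apply: functional_choice => y.
  case: (classic (c <= y <= d)) => [cy|]; last by exists (1, O); split=> //=; lra.
  have [m Hm] : exists m, E < S m y.
    apply: NNPP => N'; apply: N; exists y; split=> // m; apply: Rnot_lt_le => lt.
    by apply: N'; exists m.
  have [e [e0 He]] := cS m y (S m y - E) ltac:(lra).
  exists (e, m); split=> // _ z Hz; case: (Req_dec y z) => [<-//|yz].
  have := He z (conj (conj Logic.I yz) Hz); rewrite /= /R_dist => /Rabs_def2; rewrite /=; lra.
(* As the gauge also bounds the local index [(f v).2], any [m] above [/ e] serves at all points: the
   partial sums grow with [m]. Then [S m] exceeds [E] on the whole interval, against the mean value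
   theorem. *)
pose delta v := Rmin (f v).1 (/ (1 + INR (f v).2)).
have inv0 v : 0 < 1 + INR (f v).2 by have := pos_INR (f v).2; lra.
have delta0 v : 0 < delta v.
  by apply: Rmin_glb_lt; [case: (Hf v) | apply: Rinv_0_lt_compat].
have [e [e0 He]] := compact_gauge c d delta0.
have [m Hm] := INR_unbounded (/ e).
have Sm y : c <= y <= d -> E < S m y.
  move=> /He [t [ct [yt et]]].
  apply: (@Rlt_le_trans _ (S (f t).2 y)).
    by apply: (proj2 (Hf t)) => //; apply: Rlt_le_trans yt _; exact: Rmin_l.
  apply: (@sumR_mono_nat (fun k => lam k y)) => //.
  have et' : e <= / (1 + INR (f t).2) by apply: Rle_trans et _; exact: Rmin_r.
  have := Rinv_le_contravar _ _ e0 et'; rewrite Rinv_inv => H.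
  by apply/leP; apply: INR_le; lra.
have dS m' y : is_derive (fun y => \big[Rplus/0]_(k < m') G k y) y (S m' y).
  rewrite /S; elim: m' => [|m' IH].
    rewrite big_ord0; apply: (is_derive_ext (fun _ => 0)) => [z|]; first by rewrite big_ord0.
    exact: is_derive_const.
  rewrite big_ord_recr; apply: (is_derive_ext (fun z => \big[Rplus/0]_(k < m') G k z + G m' z))
    => [z|].
    by rewrite big_ord_recr.
  exact: is_derive_plus.
have [y [cy Hy]] := MVT_gen (fun y => \big[Rplus/0]_(k < m) G k y) c d (S m)
   (fun x _ => dS m x) (fun x _ => derivable_continuous_pt _ _ (ex_derive_Reals_0 _ _ (ex_intro _
     _ (dS m x)))).
rewrite Rmin_left ?Rmax_right in cy; try lra.
have := HE m; rewrite -sumR_sub Hy; have := Sm y cy; nra.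
Qed.

(** * Translates of a path that avoid a null set *)

Lemma ex_RInt_continuity (f : R -> R) a b : continuity f -> ex_RInt f a b.
Proof. by move=> cf; apply: ex_RInt_continuous => z _; apply/continuity_pt_filterlim. Qed.

Lemma continuity_prodR n (F : 'I_n -> R -> R) (r : seq 'I_n) :
  (forall i, continuity (F i)) -> continuity (fun s => \big[Rmult/1]_(i <- r) F i s).
Proof.
move=> cF; elim: r => [|i r IH] s.
  by apply: (continuity_pt_ext (fun _ => 1)) => [z|];
    [rewrite big_nil | exact: continuity_pt_const].
apply: (continuity_pt_ext (fun z => F i z * \big[Rmult/1]_(i <- r) F i z)) => [z|].
  by rewrite big_cons.
by apply: continuity_pt_mult; [exact: cF | exact: IH].
Qed.

(** This replaces Fubini's theorem. With [Phi] a primitive of [bump] it exhibits the time integral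
    of [bump] as a derivative in the translate [y]; with [Phi] equal to [bump] it shows that this
    integral is itself continuous in [y]. *)
Lemma is_derive_RInt_shift (psi gam Phi dPhi : R -> R) (T y : R) :
  continuity psi -> continuity gam -> continuity dPhi ->
  (forall z, is_derive Phi z (dPhi z)) ->
  is_derive (fun y => RInt (fun s => psi s * Phi (y + gam s)) 0 T) y
            (RInt (fun s => psi s * dPhi (y + gam s)) 0 T).
Proof.
move=> cpsi cgam cdPhi dP.
have d1 s z : is_derive (fun u => psi s * Phi (u + gam s)) z (psi s * dPhi (z + gam s)).
  by have := dP (z + gam s) => H; auto_derive; [by exists (dPhi (z + gam s)) | rewrite
    (is_derive_unique _ _ _ H); ring].
have cPhi : continuity Phi.
  by move=> z; apply: derivable_continuous_pt; apply: ex_derive_Reals_0; exists (dPhi z).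
have -> : RInt (fun s => psi s * dPhi (y + gam s)) 0 T =
          RInt (fun s => Derive (fun u => psi s * Phi (u + gam s)) y) 0 T.
  by apply: RInt_ext => s _; rewrite (is_derive_unique _ _ _ (d1 s y)).
apply: (is_derive_RInt_param (fun y s => psi s * Phi (y + gam s))).
- by apply: filter_forall => z s _; exists (psi s * dPhi (z + gam s)).
- move=> s _.
  apply: (continuity_2d_pt_ext (fun u v => psi v * dPhi (u + gam v))) => [u v|].
    by rewrite (is_derive_unique _ _ _ (d1 v u)).
  apply: continuity_2d_pt_mult.
    by apply: (continuity_1d_2d_pt_comp psi (fun _ v => v));
      [exact: cpsi | exact: continuity_2d_pt_id2].
  apply: (continuity_1d_2d_pt_comp dPhi (fun u v => u + gam v)); first exact: cdPhi.
  apply: continuity_2d_pt_plus; first exact: continuity_2d_pt_id1.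
  by apply: (continuity_1d_2d_pt_comp gam (fun _ v => v));
    [exact: cgam | exact: continuity_2d_pt_id2].
- apply: filter_forall => z; apply: ex_RInt_continuity => s.
  apply: continuity_pt_mult; first exact: cpsi.
  apply: (continuity_pt_comp (fun s => z + gam s) Phi); last exact: cPhi.
  by apply: continuity_pt_plus; [exact: continuity_pt_const | exact: cgam].
Qed.

(* Scaled Cauchy kernel: it exceeds [1] on [(c - r, c + r)] and its total mass is [2 PI r]. *)
Definition bump (c r z : R) : R := 2 * r ^ 2 / (r ^ 2 + (z - c) ^ 2).

Section Bump.
Variables (c r : R).
Hypothesis r0 : 0 < r.

Lemma bump_den z : 0 < r ^ 2 + (z - c) ^ 2.
Proof. by have := pow_lt r 2 r0; have := pow2_ge_0 (z - c); lra. Qed.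

Lemma bump_ge0 z : 0 <= bump c r z.
Proof.
apply: Rmult_le_pos; first by have := pow_lt r 2 r0; lra.
by apply: Rlt_le; apply: Rinv_0_lt_compat; exact: bump_den.
Qed.

Lemma bump_gt1 z : Rabs (z - c) < r -> 1 < bump c r z.
Proof.
move=> H; apply: (Rmult_lt_reg_r (r ^ 2 + (z - c) ^ 2)); first exact: bump_den.
rewrite /bump; field_simplify; last by have := bump_den z; lra.
have : (z - c) ^ 2 < r ^ 2.
  by rewrite -(pow2_abs (z - c)); have := Rabs_pos (z - c); nra.
lra.
Qed.

Lemma is_derive_bump_prim z : is_derive (fun z => 2 * r * atan ((z - c) / r)) z (bump c r z).
Proof.
auto_derive => //; rewrite /bump; field; split; last lra.
by have := bump_den z; lra.
Qed.

Lemma ex_derive_bump z : ex_derive (bump c r) z.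
Proof. by rewrite /bump; auto_derive; have := bump_den z; lra. Qed.

Lemma continuity_bump : continuity (bump c r).
Proof.
by move=> z; apply: derivable_continuous_pt; apply: ex_derive_Reals_0; exact: ex_derive_bump.
Qed.

Lemma bump_prim_le z z' :
  2 * r * atan ((z - c) / r) - 2 * r * atan ((z' - c) / r) <= 2 * PI * r.
Proof.
have [h1 h2] := atan_bound ((z - c) / r); have [h3 h4] := atan_bound ((z' - c) / r); nra.
Qed.

Lemma RInt_bump_le T : 0 <= T -> RInt (bump c r) 0 T <= 2 * PI * r.
Proof.
move=> T0.
have H := is_RInt_derive (fun z => 2 * r * atan ((z - c) / r)) (bump c r) 0 T
  (fun z _ => is_derive_bump_prim z)
  (fun z _ => proj1 (continuity_pt_filterlim _ _) (continuity_bump z)).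
rewrite (is_RInt_unique _ _ _ _ H); exact: bump_prim_le.
Qed.
End Bump.

Lemma continuity_derive_bump c r : 0 < r -> continuity (Derive (bump c r)).
Proof.
move=> r0 z.
have E u : Derive (bump c r) u = - (2 * r ^ 2) * (2 * (u - c)) / (r ^ 2 + (u - c) ^ 2) ^ 2.
  apply: is_derive_unique; rewrite /bump; auto_derive; first by have := bump_den c r0 u; lra.
  by field; have := bump_den c r0 u; lra.
apply: (continuity_pt_ext (fun u => - (2 * r ^ 2) * (2 * (u - c)) / (r ^ 2 + (u - c) ^ 2) ^ 2))
  => //.
apply: derivable_continuous_pt; apply: ex_derive_Reals_0; auto_derive.
by have := bump_den c r0 z; nra.
Qed.

(** Averaging over a single coordinate of the translate. In the application [psi k] is the product
    of the kernels of the coordinates already fixed and [W k] the product of the radii of those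
    still free. *)
Lemma choose_coordinate (psi : nat -> R -> R) (gam : R -> R) (c rho W : nat -> R)
    (T kappa E : R) : 0 <= T -> 0 < kappa ->
  (forall k, continuity (psi k)) -> (forall k s, 0 <= psi k s) -> continuity gam ->
  (forall k, 0 < rho k) -> (forall k, 0 <= W k) ->
  (forall m, \big[Rplus/0]_(k < m) (rho k * W k * RInt (psi k) 0 T) <= E) ->
  exists y, 0 <= y <= kappa /\ forall m,
    \big[Rplus/0]_(k < m)
      (W k * RInt (fun s => psi k s * bump (c k) (rho k) (y + gam s)) 0 T)
    <= 2 * PI / kappa * E.
Proof.
move=> T0 k0 cpsi psi0 cgam r0 W0 HE.
have cprod k y (Phi : R -> R) : continuity Phi -> continuity (fun s => psi k s * Phi (y + gam s)).
  move=> cPhi s; apply: continuity_pt_mult; first exact: cpsi.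
  apply: (continuity_pt_comp (fun s => y + gam s) Phi); last exact: cPhi.
  by apply: continuity_pt_plus; [exact: continuity_pt_const | exact: cgam].
pose prim k z := 2 * rho k * atan ((z - c k) / rho k).
have cprim k : continuity (prim k).
  move=> z; apply: derivable_continuous_pt; apply: ex_derive_Reals_0.
  by exists (bump (c k) (rho k) z); apply: is_derive_bump_prim.
apply: (@exists_average_point
  (fun k y => W k * RInt (fun s => psi k s * prim k (y + gam s)) 0 T)
  (fun k y => W k * RInt (fun s => psi k s * bump (c k) (rho k) (y + gam s)) 0 T)) => //.
- move=> k x; apply: is_derive_scal.
  apply: is_derive_RInt_shift => //; first exact: continuity_bump.
  by move=> z; exact: is_derive_bump_prim.
(* Continuity in the translate is obtained from differentiability, by differentiating [bump] under
   the integral. *)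
- move=> k x; apply: derivable_continuous_pt; apply: ex_derive_Reals_0.
  exists (W k * RInt (fun s => psi k s * Derive (bump (c k) (rho k)) (x + gam s)) 0 T).
  apply: is_derive_scal; apply: is_derive_RInt_shift => //; first exact: continuity_derive_bump.
  by move=> z; apply: Derive_correct; apply: ex_derive_bump.
- move=> k x; apply: Rmult_le_pos => //; apply: RInt_ge_0 => //.
    by apply: ex_RInt_continuity; apply: cprod; exact: continuity_bump.
  by move=> s _; apply: Rmult_le_pos => //; exact: bump_ge0.
(* Between the translates 0 and [kappa] the primitive grows by at most [2 * PI * rho k] at each time
   [s]; division by the length [kappa] gives the average. *)
- move=> m; apply: (@Rle_trans _ (2 * PI * E)); last by apply: Req_le; field; lra.
  apply: Rle_trans (_ : \big[Rplus/0]_(k < m) (2 * PI * (rho k * W k * RInt (psi k) 0 T)) <= _).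
    apply: sumR_le => k _.
    have e1 := ex_RInt_continuity 0 T (cprod k kappa _ (cprim k)).
    have e2 := ex_RInt_continuity 0 T (cprod k 0 _ (cprim k)).
    rewrite -Rmult_minus_distr_l; replace (2 * PI * _) with (W k * (2 * PI * rho k * RInt (psi k)
      0 T)) by ring.
    apply: Rmult_le_compat_l => //.
    have -> : 2 * PI * rho k * RInt (psi k) 0 T = RInt (fun s => 2 * PI * rho k * psi k s) 0 T.
      by symmetry; apply: RInt_scal; exact: ex_RInt_continuity.
    have -> : RInt (fun s => psi k s * prim k (kappa + gam s)) 0 T - RInt (fun s => psi k s *
      prim k (0 + gam s)) 0 T
      = RInt (fun s => psi k s * prim k (kappa + gam s) - psi k s * prim k (0 + gam s)) 0 T.
      by symmetry; apply: RInt_minus.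
    apply: RInt_le => //; first exact: (ex_RInt_minus _ _ _ _ e1 e2).
      by apply: (@ex_RInt_scal R_NormedModule (psi k)); exact: ex_RInt_continuity.
    move=> s _; rewrite -Rmult_minus_distr_l Rmult_comm; apply: Rmult_le_compat_r => //.
    exact: bump_prim_le.
  rewrite -big_distrr /=; apply: Rmult_le_compat_l; last exact: HE.
  by have := PI_RGT_0; lra.
Qed.

(** Induction on the list of free coordinates: fixing one moves its radius out of the weight and its
    kernel into [psi], at the price of a factor [2 * PI / kappa]. Initially [psi] is 1, whose
    integral is [T]. *)
Lemma choose_shift n (gam : 'I_n -> R -> R) (c rho : nat -> 'I_n -> R) (T kappa E : R) :
  0 <= T -> 0 < kappa ->
  (forall i, continuity (gam i)) -> (forall k i, 0 < rho k i) ->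
  (forall m, \big[Rplus/0]_(k < m) \big[Rmult/1]_(i < n) rho k i <= E) ->
  exists y : 'I_n -> R, (forall i, 0 <= y i <= kappa) /\ forall m,
    \big[Rplus/0]_(k < m)
      RInt (fun s => \big[Rmult/1]_(i < n) bump (c k i) (rho k i) (y i + gam i s)) 0 T
    <= (2 * PI / kappa) ^ n * (T * E).
Proof.
move=> T0 k0 cgam r0 HE.
suff main (r : seq 'I_n) : uniq r -> forall (psi : nat -> R -> R) (E : R),
  (forall k, continuity (psi k)) -> (forall k s, 0 <= psi k s) ->
  (forall m, \big[Rplus/0]_(k < m) ((\big[Rmult/1]_(i <- r) rho k i) * RInt (psi k) 0 T) <= E) ->
  exists y : 'I_n -> R, (forall i, 0 <= y i <= kappa) /\ forall m,
    \big[Rplus/0]_(k < m)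
      RInt (fun s => psi k s * \big[Rmult/1]_(i <- r) bump (c k i) (rho k i) (y i + gam i s)) 0 T
    <= (2 * PI / kappa) ^ (size r) * E.
  have [|||y [y0 Hy]] := main (index_enum 'I_n) (index_enum_uniq _) (fun _ _ => 1) (T * E).
  - by move=> k s; exact: continuity_pt_const.
  - by move=> *; lra.
  - move=> m; rewrite RInt_const; rewrite /scal /= /mult /=.
    apply: Rle_trans (_ : T * \big[Rplus/0]_(k < m) \big[Rmult/1]_(i < n) rho k i <= _).
      by rewrite big_distrr /=; apply: Req_le; apply: eq_bigr => k _;
        rewrite Rminus_0_r Rmult_1_r Rmult_comm.
    exact: Rmult_le_compat_l.
  exists y; split=> // m; have := Hy m.
  have -> : size (index_enum 'I_n) = n by rewrite -[RHS]card_ord cardE enumT.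
  by move=> H; apply: Rle_trans H; apply: Req_le; apply: eq_bigr => k _; apply: RInt_ext => s _;
    rewrite Rmult_1_l.
elim: r => [|l r IH] /=.
  move=> _ psi E' cpsi psi0 HE'; exists (fun _ => 0); split=> [i|m]; first lra.
  rewrite Rmult_1_l; apply: Rle_trans (HE' m); apply: Req_le; apply: eq_bigr => k _.
  by rewrite big_nil Rmult_1_l; apply: RInt_ext => s _; rewrite big_nil Rmult_1_r.
move=> /andP [lr ur] psi E' cpsi psi0 HE'.
have [||y [y0 Hy]] := @choose_coordinate psi (gam l) (fun k => c k l) (fun k => rho k l)
    (fun k => \big[Rmult/1]_(i <- r) rho k i) T kappa E' T0 k0 cpsi psi0 (cgam l) (fun k => r0 k l).
- by move=> k; apply: prodR_ge0 => i _; apply: Rlt_le.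
- by move=> m; apply: Rle_trans (HE' m); apply: Req_le; apply: eq_bigr => k _; rewrite big_cons.
have [||y' [y'0 Hy']] := IH ur (fun k s => psi k s * bump (c k l) (rho k l) (y + gam l s)) _ _ _ Hy.
- move=> k s; apply: continuity_pt_mult; first exact: cpsi.
  apply: (continuity_pt_comp (fun s => y + gam l s) (bump (c k l) (rho k l)));
    last exact: continuity_bump.
  by apply: continuity_pt_plus; [exact: continuity_pt_const | exact: cgam].
- by move=> k s; apply: Rmult_le_pos => //; exact: bump_ge0.
exists (upd y' l y); split=> [i|m]; first by rewrite /upd; case: eqP.
have -> : 2 * PI / kappa * (2 * PI / kappa) ^ size r * E' =
  (2 * PI / kappa) ^ size r * (2 * PI / kappa * E') by ring.
apply: Rle_trans (Hy' m); apply: Req_le; apply: eq_bigr => k _; apply: RInt_ext => s _.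
rewrite big_cons {1}/upd eqxx -Rmult_assoc; congr (_ * _).
by apply: eq_big_seq => i ir; rewrite /upd; case: eqP => // il; rewrite -il ir in lr.
Qed.

(** [m] is a clock that runs at unit speed or faster just after [t]. An exceptional set of times is
    negligible when such a clock, started at each of its points, advances very little in total. *)
Definition right_gain (m : R -> R) (T t : R) : Prop :=
  exists d, 0 < d /\ forall s, t < s < t + d -> s <= T -> s - t <= m s - m t.

(** The clock is the supremum over [M] of the integrals from 0 of the first [M] functions. If
    [beta k] exceeds 1 at [t], it does so nearby, and its integral alone already advances at unit
    speed. *)
Lemma gain_function (beta : nat -> R -> R) (T E : R) : 0 <= T ->
  (forall k, continuity (beta k)) -> (forall k s, 0 <= beta k s) ->
  (forall M, \big[Rplus/0]_(k < M) RInt (beta k) 0 T <= E) ->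
  exists m : R -> R, (forall t s, 0 <= t -> t <= s -> s <= T -> m t <= m s) /\
    0 <= m 0 /\ m T <= E /\
    forall k t, 0 <= t < T -> 1 < beta k t -> right_gain m T t.
Proof.
move=> T0 cb b0 HE.
pose S M s := \big[Rplus/0]_(k < M) RInt (beta k) 0 s.
have ib k a b := ex_RInt_continuity a b (cb k).
have Ib k a b : a <= b -> 0 <= RInt (beta k) a b by move=> ab; apply: RInt_ge_0.
have Chas k t s : RInt (beta k) 0 s = RInt (beta k) 0 t + RInt (beta k) t s.
  by rewrite -(RInt_Chasles (beta k) 0 t s) //; exact: ib.
have Smono M t s : t <= s -> S M t <= S M s.
  by move=> ts; apply: sumR_le => k _; rewrite (Chas k t s); have := Ib k t s ts; lra.
have [m Hm] : exists m, forall s, s <= T -> is_lub (fun v => exists M, v = S M s) (m s).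
  apply: (functional_choice (fun s l => s <= T -> is_lub (fun v => exists M, v = S M s) l)) => s.
  (* Beyond [T] the partial sums have no known bound, and the value 0 is arbitrary. *)
  case: (Rle_lt_dec s T) => sT; last by exists 0; lra.
  have [||l Hl] := completeness (fun v => exists M, v = S M s).
  - by exists E => _ [M ->]; apply: Rle_trans (HE M); exact: Smono.
  - by exists (S O s), O.
  by exists l.
have gain k t s : t <= s -> 0 <= t -> s <= T -> m t + RInt (beta k) t s <= m s.
  move=> ts t0 sT; suff : m t <= m s - RInt (beta k) t s by lra.
  apply: (proj2 (Hm t ltac:(lra))) => _ [M ->].
  (* A partial sum that extends the given one and contains the term of index [k]. *)
  pose M' := maxn M k.+1.
  have H1 : S M t <= S M' t.
    by apply: (@sumR_mono_nat (fun k => RInt (beta k) 0 t)); [move=> j;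
      exact: Ib | exact: leq_maxl].
  have H2 : S M' s <= m s by apply: (proj1 (Hm s sT)); exists M'.
  have H3 : RInt (beta k) t s <= S M' s - S M' t.
    rewrite /S sumR_sub.
    have kM : (k < M')%nat by exact: leq_maxr.
    have := @sumR_term _ xpredT (fun j : 'I_M' => RInt (beta j) 0 s - RInt (beta j) 0 t) (Ordinal
      kM).
    rewrite /= (Chas k t s) => H; apply: Rle_trans (H _ _) => //; first by lra.
    by move=> j _; rewrite (Chas j t s); have := Ib j t s ts; lra.
  by lra.
exists m; split; [|split; [|split]].
- move=> t s t0 ts sT; have := gain O t s ts t0 sT; have := Ib O t s ts; lra.
- by apply: (proj1 (Hm 0 T0)); exists O; rewrite /S big_ord0.
- by apply: (proj2 (Hm T (Rle_refl T))) => _ [M ->]; exact: HE.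
move=> k t [t0 tT] bt.
have [d [d0 Hd]] := cb k t (beta k t - 1) ltac:(lra).
exists d; split=> // s [ts sd] sT.
have := gain k t s ltac:(lra) t0 sT.
suff : s - t <= RInt (beta k) t s by lra.
have -> : s - t = RInt (fun _ => 1) t s.
  by rewrite RInt_const /scal /= /mult /= Rmult_1_r.
apply: RInt_le => //; [lra | by apply: ex_RInt_const | move=> z [tz zs]].
have := Hd z; rewrite /= /R_dist => H.
have := H (conj (conj Logic.I (Rlt_not_eq _ _ tz)) _); rewrite Rabs_right; last lra.
by move=> /(_ ltac:(lra)) /Rabs_def2; lra.
Qed.

(** Boxes of a cover may be degenerate, whereas kernels need positive radii. The product of the
    [a i + d] is continuous at [d = 0], and bounding half-sides by full sides only weakens the
    estimate. *)
Lemma prodR_enlarge n (a : 'I_n -> R) (e : R) : (forall i, 0 <= a i) -> 0 < e ->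
  exists d, 0 < d /\ \big[Rmult/1]_(i < n) (a i / 2 + d) <= \big[Rmult/1]_(i < n) a i + e.
Proof.
move=> a0 e0.
have c i : continuity (fun d => a i + d).
  by move=> z; apply: continuity_pt_plus; [exact: continuity_pt_const | exact: continuity_pt_id].
have [d [d0 Hd]] := @continuity_prodR n (fun i d => a i + d) (index_enum _) c 0 e e0.
exists (d / 2); split; first lra.
have dd : Rabs (d / 2 - 0) < d by rewrite Rminus_0_r Rabs_right; lra.
have [H _] := Rabs_def2 _ _ (Hd (d / 2) (conj (conj Logic.I (Rlt_not_eq 0 (d / 2) ltac:(lra))) dd)).
have E : \big[Rmult/1]_(i < n) (a i + 0) = \big[Rmult/1]_(i < n) a i.
  by apply: eq_bigr => i _; rewrite Rplus_0_r.
have {}H : \big[Rmult/1]_(i < n) (a i + d / 2) - \big[Rmult/1]_(i < n) a i < e by rewrite -E.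
suff : \big[Rmult/1]_(i < n) (a i / 2 + d / 2) <= \big[Rmult/1]_(i < n) (a i + d / 2) by lra.
suff : 0 <= \big[Rmult/1]_(i < n) (a i / 2 + d / 2) <= \big[Rmult/1]_(i < n) (a i + d / 2) by lra.
apply: (big_ind2 (fun u v => 0 <= u <= v)) => [|u1 v1 u2 v2 H1 H2|i _]; first lra.
  by split; [apply: Rmult_le_pos | apply: Rmult_le_compat]; lra.
by have := a0 i; lra.
Qed.

(** Half of [e] goes to the volumes of the closed boxes; the other half is split geometrically among
    the enlargements that make them open with positive radii. *)
Lemma null_set_radii n (N : ('I_n -> R) -> Prop) (e : R) : null_set N -> 0 < e ->
  exists c rho : nat -> 'I_n -> R, (forall k i, 0 < rho k i) /\
    (forall x, N x -> exists k, forall i, Rabs (x i - c k i) < rho k i) /\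
    (forall m, \big[Rplus/0]_(k < m) \big[Rmult/1]_(i < n) rho k i <= e).
Proof.
move=> HN e0; have [a [b [ab [cov vol]]]] := HN (e / 2) ltac:(lra).
have p0 k : 0 < (e / 2) * (1 / 2) ^ k.+1.
  by apply: Rmult_lt_0_compat; [lra | apply: pow_lt; lra].
have [d Hd] : exists d, forall k, 0 < d k /\
    \big[Rmult/1]_(i < n) ((b k i - a k i) / 2 + d k) <=
    \big[Rmult/1]_(i < n) (b k i - a k i) + (e / 2) * (1 / 2) ^ k.+1.
  apply: (functional_choice (fun k d => 0 < d /\
    \big[Rmult/1]_(i < n) ((b k i - a k i) / 2 + d) <=
    \big[Rmult/1]_(i < n) (b k i - a k i) + (e / 2) * (1 / 2) ^ k.+1)) => k.
  by apply: prodR_enlarge => [i|]; [have := ab k i; lra | exact: p0].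
exists (fun k i => (a k i + b k i) / 2), (fun k i => (b k i - a k i) / 2 + d k).
split; [|split].
- by move=> k i; have := ab k i; have := proj1 (Hd k); lra.
- move=> x /cov [k Hk]; exists k => i; have := Hk i; have := proj1 (Hd k).
  by move=> *; apply: Rabs_def1; lra.
move=> m.
have geo : \big[Rplus/0]_(k < m) ((e / 2) * (1 / 2) ^ k.+1) = (e / 2) * (1 - (1 / 2) ^ m).
  elim: m => [|m IH]; first by rewrite big_ord0 /=; lra.
  by rewrite big_ord_recr /= IH; field.
apply: Rle_trans (_ : \big[Rplus/0]_(k < m) (\big[Rmult/1]_(i < n) (b k i - a k i) +
    (e / 2) * (1 / 2) ^ k.+1) <= _).
  by apply: sumR_le => k _; case: (Hd k).
rewrite big_split /= geo; have pm := pow_lt (1 / 2) m ltac:(lra).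
have ep := Rmult_lt_0_compat _ _ e0 pm.
apply: Rle_trans (Rplus_le_compat_r _ _ _ (Rlt_le _ _ (vol m))) _; lra.
Qed.

Lemma prodR_gt1 n (F : 'I_n -> R) : (0 < n)%nat -> (forall i, 1 < F i) ->
  1 < \big[Rmult/1]_(i < n) F i.
Proof.
case: n F => // n F _ H; rewrite big_ord_recl.
have : 1 <= \big[Rmult/1]_(i < n) F (lift ord0 i).
  by apply: (big_ind (fun u => 1 <= u)) => [|u v|i _]; [lra | nra | apply: Rlt_le].
by have := H ord0; nra.
Qed.

(** When the translated path meets [N] it lies in some open box, where every kernel exceeds 1, hence
    so does their product; this needs at least one factor. The volume of the cover is
    [eta / (A + 1)], where [A] is the total cost of the n averages. *)
Lemma null_set_gain n (N : ('I_n -> R) -> Prop) (gam : 'I_n -> R -> R) (T kappa eta : R) :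
  (0 < n)%nat -> null_set N -> (forall i, continuity (gam i)) ->
  0 <= T -> 0 < kappa -> 0 < eta ->
  exists (y : 'I_n -> R) (m : R -> R), (forall i, 0 <= y i <= kappa) /\
    (forall t s, 0 <= t -> t <= s -> s <= T -> m t <= m s) /\
    0 <= m 0 /\ m T <= eta /\
    forall t, 0 <= t < T -> N (fun i => y i + gam i t) -> right_gain m T t.
Proof.
move=> n0 HN cg T0 k0 eta0.
pose A := (2 * PI / kappa) ^ n * T.
have A0 : 0 <= A.
  apply: Rmult_le_pos => //; apply: pow_le; apply: Rmult_le_pos; first by have := PI_RGT_0; lra.
  by apply: Rlt_le; exact: Rinv_0_lt_compat.
have e0 : 0 < eta / (A + 1) by apply: Rdiv_lt_0_compat; lra.
have [c [rho [r0 [cov vol]]]] := null_set_radii HN e0.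
have [y [y0 Hy]] := @choose_shift n gam c rho T kappa _ T0 k0 cg r0 vol.
have cbump k i : continuity (fun s => bump (c k i) (rho k i) (y i + gam i s)).
  move=> s; apply: (continuity_pt_comp (fun s => y i + gam i s) (bump (c k i) (rho k i))).
    by apply: continuity_pt_plus; [exact: continuity_pt_const | exact: cg].
  exact: continuity_bump.
have [|||m [mm [m0 [mT gain]]]] := @gain_function
  (fun k s => \big[Rmult/1]_(i < n) bump (c k i) (rho k i) (y i + gam i s)) T eta T0.
- by move=> k; apply: continuity_prodR => i; exact: cbump.
- by move=> k s; apply: prodR_ge0 => i _; exact: bump_ge0.
- move=> M; apply: Rle_trans (Hy M) _; rewrite -Rmult_assoc -/A.
  have -> : A * (eta / (A + 1)) = eta - eta / (A + 1) by field; lra.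
  by lra.
exists y, m; do !split=> //; try exact: (proj1 (y0 _)); try exact: (proj2 (y0 _)).
move=> t tT /cov [k Hk]; apply: (gain k) => //.
by apply: prodR_gt1 => // i; apply: bump_gt1.
Qed.

Lemma null1_gain (N : R -> Prop) (T eta : R) : null1 N -> 0 <= T -> 0 < eta ->
  exists m : R -> R,
    (forall t s, 0 <= t -> t <= s -> s <= T -> m t <= m s) /\
    0 <= m 0 /\ m T <= eta /\
    forall t, 0 <= t < T -> N t -> right_gain m T t.
Proof.
move=> HN T0 eta0; have P0 := PI_RGT_0.
have e0 : 0 < eta / (2 * PI) by apply: Rdiv_lt_0_compat; lra.
have [c [rho [r0 [cov vol]]]] := null_set_radii HN e0.
have [|||m [mm [m0 [mT gain]]]] := @gain_function (fun k => bump (c k ord0) (rho k ord0)) T eta T0.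
- by move=> k; exact: continuity_bump.
- by move=> k s; exact: bump_ge0.
- move=> M; apply: Rle_trans (_ : 2 * PI * \big[Rplus/0]_(k < M) \big[Rmult/1]_(i < 1) rho k i <=
  _).
    rewrite big_distrr /=; apply: sumR_le => k _; rewrite big_ord1; exact: RInt_bump_le.
  have -> : eta = 2 * PI * (eta / (2 * PI)) by field; lra.
  by apply: Rmult_le_compat_l; [lra | exact: vol].
exists m; do !split=> //.
move=> t tT Nt; have [k Hk] := cov (fun _ => t) Nt.
by apply: (gain k) => //; apply: bump_gt1.
Qed.

(** * Minors *)

Definition sgnR p (s : 'S_p) : R := if odd_perm s then -1 else 1.

Lemma sgnRM p (s t : 'S_p) : sgnR (s * t)%g = sgnR s * sgnR t.
Proof. by rewrite /sgnR odd_permM; do 2!case: odd_perm => /=; ring. Qed.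

Lemma sgnRV p (s : 'S_p) : sgnR (s^-1)%g = sgnR s.
Proof. by rewrite /sgnR odd_permV. Qed.

Lemma sgnR_abs p (s : 'S_p) : Rabs (sgnR s) = 1.
Proof. by rewrite /sgnR; case: ifP => _; rewrite ?Rabs_Ropp Rabs_R1. Qed.

Lemma eq_detR p (A B : 'I_p -> 'I_p -> R) : (forall a b, A a b = B a b) -> detR A = detR B.
Proof.
by move=> H; apply: eq_bigr => s _; congr (_ * _); apply: eq_bigr => a _; exact: H.
Qed.

Lemma detR_row_perm p (A : 'I_p -> 'I_p -> R) (s : 'S_p) :
  detR (fun a b => A (s a) b) = sgnR s * detR A.
Proof.
rewrite /detR (reindex_inj (mulgI s)) big_distrr /=; apply: eq_bigr => t _.
rewrite -/(sgnR (s * t)%g) -/(sgnR t) sgnRM Rmult_assoc; congr (_ * (_ * _)).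
rewrite [RHS](reindex_inj (@perm_inj _ s)) /=.
by apply: eq_bigr => a _; rewrite permM.
Qed.

Lemma detR_col_perm p (A : 'I_p -> 'I_p -> R) (s : 'S_p) :
  detR (fun a b => A a (s b)) = sgnR s * detR A.
Proof.
rewrite /detR (reindex_inj (mulIg (s^-1)%g)) big_distrr /=; apply: eq_bigr => t _.
rewrite -/(sgnR (t * s^-1)%g) -/(sgnR t) sgnRM sgnRV (Rmult_comm (sgnR t)) Rmult_assoc.
congr (_ * (_ * _)); apply: eq_bigr => a _.
by rewrite -permM mulgKV.
Qed.

Lemma sgnR_tperm p (i j : 'I_p) : i != j -> sgnR (tperm i j) = -1.
Proof. by move=> ij; rewrite /sgnR odd_tperm ij. Qed.

Lemma detR_row_eq0 p (A : 'I_p -> 'I_p -> R) (i j : 'I_p) : i != j ->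
  (forall b, A i b = A j b) -> detR A = 0.
Proof.
move=> ij H; have := detR_row_perm A (tperm i j); rewrite sgnR_tperm //.
rewrite (@eq_detR _ (fun a b => A (tperm i j a) b) A); first lra.
by move=> a b; case: tpermP => [->|->|].
Qed.

Lemma detR_col_eq0 p (A : 'I_p -> 'I_p -> R) (i j : 'I_p) : i != j ->
  (forall a, A a i = A a j) -> detR A = 0.
Proof.
move=> ij H; have := detR_col_perm A (tperm i j); rewrite sgnR_tperm //.
rewrite (@eq_detR _ (fun a b => A a (tperm i j b)) A); first lra.
by move=> a b; case: tpermP => [->|->|].
Qed.

(** The norm of Lambda_p sees only increasing tuples, but replacing an entry of a tuple destroys the
    order; this dichotomy brings every tuple back to the increasing ones. *)
Lemma tuple_increasing p m (J : p.-tuple 'I_m) :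
  (exists i j : 'I_p, i != j /\ tnth J i = tnth J j) \/
  exists (J' : p.-tuple 'I_m) (s : 'S_p), incr_idx J' /\ forall i, tnth J i = tnth J' (s i).
Proof.
case: (boolP (uniq J)) => uJ; last first.
  left; apply: NNPP => N; case/negP: uJ; apply/tuple_uniqP => i j eij.
  by case: (eqVneq i j) => // ij; case: N; exists i, j.
right; pose le := fun a b : 'I_m => leq a b.
have sz : size (sort le J) == p by rewrite size_sort size_tuple.
pose J' := Tuple sz.
have pJ : perm_eq J J' by rewrite perm_sym perm_sort.
have [s Hs] := tuple_permP pJ.
exists J', s; split; last first.
  by move=> i; rewrite (tnth_nth (tnth J i)) Hs -(tnth_nth _ [tuple tnth J' (s i) | i < p])
    tnth_mktuple.
rewrite /incr_idx /=.
have -> : sorted (fun a b : 'I_m => ltn a b) (sort le J) = sorted ltn (map val (sort le J)).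
  by rewrite sorted_map.
rewrite ltn_sorted_uniq_leq map_inj_uniq ?sort_uniq ?uJ; last exact: val_inj.
rewrite sorted_map; apply: sort_sorted => a b; exact: leq_total.
Qed.

(** A repeated index gives two equal rows or columns and a zero minor; otherwise sorting both tuples
    changes the minor only by a sign. *)
Lemma YIK_le_LamNorm q n (g : 'I_q -> ('I_n -> R) -> ('I_n -> R)) p
    (J : p.-tuple 'I_q) (K : p.-tuple 'I_n) x : Rabs (YIK g J K x) <= LamNorm g p x.
Proof.
have L0 := LamNorm_ge0 g p x.
case: (tuple_increasing J) => [[i [j [ij E]]]|[J' [s [iJ EJ]]]].
  rewrite /YIK (@detR_col_eq0 _ _ i j) ?Rabs_R0 // => a; by rewrite E.
case: (tuple_increasing K) => [[i [j [ij E]]]|[K' [t [iK EK]]]].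
  rewrite /YIK (@detR_row_eq0 _ _ i j) ?Rabs_R0 // => a; by rewrite E.
have -> : YIK g J K x = sgnR t * (sgnR s * YIK g J' K' x).
  rewrite /YIK -(detR_col_perm (fun a b => g (tnth J' b) x (tnth K' a))).
  rewrite -(detR_row_perm (fun a b => g (tnth J' (s b)) x (tnth K' a))).
  by apply: eq_detR => a b; rewrite EJ EK.
rewrite !Rabs_mult !sgnR_abs !Rmult_1_l LamNormE.
by apply: (@l2_coord _ (@incr_pair q n p) (fun JK => YIK g JK.1 JK.2 x) (J', K'));
  rewrite /incr_pair iJ.
Qed.

Lemma derivable_pt_lim_sumR (I : Type) (r : seq I) (P : pred I) (f : I -> R -> R) (df : I -> R) t :
  (forall a, P a -> derivable_pt_lim (f a) t (df a)) ->
  derivable_pt_lim (fun s => \big[Rplus/0]_(a <- r | P a) f a s) t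
    (\big[Rplus/0]_(a <- r | P a) df a).
Proof.
move=> H; elim: r => [|a r IH].
  rewrite big_nil; apply: (derivable_pt_lim_ext (fun _ => 0)) => [z|]; first by rewrite big_nil.
  exact: derivable_pt_lim_const.
rewrite big_cons; case: ifP => Pa.
  apply: (derivable_pt_lim_ext (fun s => f a s + \big[Rplus/0]_(a <- r | P a) f a s)) => [z|].
    by rewrite big_cons Pa.
  by apply: derivable_pt_lim_plus => //; exact: H.
by apply: derivable_pt_lim_ext IH => z; rewrite big_cons Pa.
Qed.

Lemma derivable_pt_lim_prodR (I : eqType) (r : seq I) (f : I -> R -> R) (df : I -> R) t :
  uniq r -> (forall a, derivable_pt_lim (f a) t (df a)) ->
  derivable_pt_lim (fun s => \big[Rmult/1]_(a <- r) f a s) t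
    (\big[Rplus/0]_(a <- r) \big[Rmult/1]_(a' <- r) (if a' == a then df a' else f a' t)).
Proof.
move=> + H; elim: r => [|a r IH] /=.
  move=> _; rewrite big_nil; apply: (derivable_pt_lim_ext (fun _ => 1)) => [z|];
    first by rewrite big_nil.
  exact: derivable_pt_lim_const.
move=> /andP [ar ur]; rewrite big_cons.
apply: (derivable_pt_lim_ext (fun s => f a s * \big[Rmult/1]_(a <- r) f a s)) => [z|].
  by rewrite big_cons.
rewrite [X in X + _](_ : _ = df a * \big[Rmult/1]_(a' <- r) f a' t).
  rewrite [X in _ + X](_ : _ = f a t * \big[Rplus/0]_(a0 <- r)
        \big[Rmult/1]_(a' <- r) (if a' == a0 then df a' else f a' t)).
    by apply: derivable_pt_lim_mult; [exact: H | exact: IH].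
  rewrite big_distrr /=; apply: eq_big_seq => b br; rewrite big_cons.
  by case: eqP => // ab; rewrite ab br in ar.
rewrite big_cons eqxx; congr (_ * _); apply: eq_big_seq => b br.
by case: eqP => // ab; rewrite -ab br in ar.
Qed.

(** The differential of the determinant at [A] in the direction [N], expanded along rows. *)
Definition detR' p (A N : 'I_p -> 'I_p -> R) : R :=
  \big[Rplus/0]_(a < p) detR (fun a' b => if a' == a then N a' b else A a' b).

Lemma derivable_pt_lim_detR p (A : R -> 'I_p -> 'I_p -> R) (dA : 'I_p -> 'I_p -> R) t :
  (forall a b, derivable_pt_lim (fun s => A s a b) t (dA a b)) ->
  derivable_pt_lim (fun s => detR (A s)) t (detR' (A t) dA).
Proof.
move=> H; rewrite /detR' /detR exchange_big /=.
apply: derivable_pt_lim_sumR => s _; rewrite -big_distrr /=.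
apply: derivable_pt_lim_scal.
apply: (@derivable_pt_lim_prodR _ (index_enum _) (fun a z => A z a (s a)) (fun a => dA a (s a)))
  => //.
exact: index_enum_uniq.
Qed.

(** In the term of a permutation [s], replacing the factor of row [a] is replacing that of column
    [s a]. The same differential can thus be read by rows when [N] acts on the coordinates, and by
    columns when it combines the fields. *)
Lemma detR'_col p (A N : 'I_p -> 'I_p -> R) :
  detR' A N = \big[Rplus/0]_(b < p) detR (fun a b' => if b' == b then N a b' else A a b').
Proof.
rewrite /detR' /detR exchange_big [RHS]exchange_big /=; apply: eq_bigr => s _.
rewrite -!big_distrr /=; congr (_ * _); rewrite [RHS](reindex_inj (@perm_inj _ s)) /=.
apply: eq_bigr => a _; apply: eq_bigr => a' _.
by rewrite (inj_eq (@perm_inj _ s)).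
Qed.

Lemma prodR_lin (I L : finType) (i : I) (M : L -> R) (X : L -> I -> R) (A : I -> R) :
  \big[Rmult/1]_(j : I) (if j == i then \big[Rplus/0]_(l : L) (M l * X l j) else A j) =
  \big[Rplus/0]_(l : L) (M l * \big[Rmult/1]_(j : I) (if j == i then X l j else A j)).
Proof.
rewrite (bigD1 i) //= eqxx big_distrl /=; apply: eq_bigr => l _.
rewrite [in RHS](bigD1 i) //= eqxx Rmult_assoc; congr (_ * (_ * _)).
by apply: eq_bigr => j /negbTE ->.
Qed.

Lemma detR_row_lin p (L : finType) (a : 'I_p) (M : L -> R) (X : L -> 'I_p -> 'I_p ->
  R) (A : 'I_p -> 'I_p -> R) :
  detR (fun a' b => if a' == a then \big[Rplus/0]_(l : L) (M l * X l a' b) else A a' b) =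
  \big[Rplus/0]_(l : L) (M l * detR (fun a' b => if a' == a then X l a' b else A a' b)).
Proof.
rewrite /detR (eq_bigr (fun l => \big[Rplus/0]_(s : 'S_p) (M l * (sgnR s *
   \big[Rmult/1]_(a' < p) (if a' == a then X l a' (s a') else A a' (s a')))))); last first.
  by move=> l _; rewrite big_distrr.
rewrite exchange_big /=; apply: eq_bigr => s _.
rewrite (@prodR_lin _ _ a M (fun l a' => X l a' (s a'))) big_distrr /=; apply: eq_bigr => l _.
by rewrite -/(sgnR s) -!Rmult_assoc (Rmult_comm (sgnR s)).
Qed.

Lemma detR_col_lin p (L : finType) (b : 'I_p) (M : L -> R) (X : L -> 'I_p -> 'I_p ->
  R) (A : 'I_p -> 'I_p -> R) :
  detR (fun a b' => if b' == b then \big[Rplus/0]_(l : L) (M l * X l a b') else A a b') =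
  \big[Rplus/0]_(l : L) (M l * detR (fun a b' => if b' == b then X l a b' else A a b')).
Proof.
rewrite /detR (eq_bigr (fun l => \big[Rplus/0]_(s : 'S_p) (M l * (sgnR s *
   \big[Rmult/1]_(a < p) (if s a == b then X l a (s a) else A a (s a)))))); last first.
  by move=> l _; rewrite big_distrr.
rewrite exchange_big /=; apply: eq_bigr => s _.
(* In the term of [s], column [b] is met exactly at the row [s^-1 b], which reduces to one modified
   factor. *)
have E (Y : 'I_p -> R) : \big[Rmult/1]_(a < p) (if s a == b then Y a else A a (s a)) =
   \big[Rmult/1]_(a < p) (if a == (s^-1)%g b then Y a else A a (s a)).
  by apply: eq_bigr => a _; rewrite -{1}(permKV s b) (inj_eq (@perm_inj _ s)).
rewrite E (@prodR_lin _ _ _ M (fun l a => X l a (s a))) big_distrr /=; apply: eq_bigr => l _.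
by rewrite -/(sgnR s) E -!Rmult_assoc (Rmult_comm (sgnR s)).
Qed.

Lemma eq_detR' p (A N N' : 'I_p -> 'I_p -> R) : (forall a b, N a b = N' a b) ->
  detR' A N = detR' A N'.
Proof. by move=> H; apply: eq_bigr => a _; apply: eq_detR => a' b; case: ifP. Qed.

Lemma detR'_lin p (L : finType) (M : L -> R) (X : L -> 'I_p -> 'I_p -> R) (A : 'I_p -> 'I_p -> R) :
  detR' A (fun a b => \big[Rplus/0]_(l : L) (M l * X l a b)) =
  \big[Rplus/0]_(l : L) (M l * detR' A (X l)).
Proof.
rewrite /detR' (eq_bigr _ (fun a _ => detR_row_lin a M X A)) exchange_big /=.
by apply: eq_bigr => l _; rewrite big_distrr.
Qed.

Lemma detR'_add p (A N N' : 'I_p -> 'I_p -> R) :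
  detR' A (fun a b => N a b + N' a b) = detR' A N + detR' A N'.
Proof.
have := detR'_lin (fun _ : bool => 1) (fun l : bool => if l then N else N') A.
rewrite big_bool /= !Rmult_1_l => <-.
by apply: eq_detR' => a b; rewrite big_bool /= !Rmult_1_l.
Qed.

(** * Size and Lipschitz bounds for determinants *)

Section DetBounds.
Variables (G e : R).
Hypotheses (G1 : 1 <= G) (e0 : 0 <= e).

Lemma prodR_le_pow (I : Type) (r : seq I) (P : pred I) (F : I -> R) :
  (forall i, Rabs (F i) <= G) -> Rabs (\big[Rmult/1]_(i <- r | P i) F i) <= G ^ size r.
Proof.
move=> H; elim: r => [|i r IH]; first by rewrite big_nil Rabs_R1 /=; lra.
have G0 : 0 <= G ^ size r by apply: pow_le; lra.
rewrite big_cons /=; case: ifP => _; last by nra.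
rewrite Rabs_mult; apply: Rmult_le_compat => //; exact: Rabs_pos.
Qed.

Lemma prodR_lip (I : Type) (r : seq I) (F H : I -> R) :
  (forall i, Rabs (F i) <= G) -> (forall i, Rabs (H i) <= G) ->
  (forall i, Rabs (F i - H i) <= e) ->
  Rabs (\big[Rmult/1]_(i <- r) F i - \big[Rmult/1]_(i <- r) H i) <=
    INR (size r) * G ^ size r * e.
Proof.
move=> FG HG FH; elim: r => [|i r IH].
  by rewrite !big_nil /= Rminus_diag Rabs_R0; lra.
rewrite !big_cons.
set a := \big[_/_]_(_ <- _) _ in IH *; set b := \big[_/_]_(_ <- _) _ in IH *.
have -> : F i * a - H i * b = F i * (a - b) + (F i - H i) * b by ring.
have bG : Rabs b <= G ^ size r by apply: prodR_le_pow.
have G0 : 0 <= G ^ size r by apply: pow_le; lra.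
apply: Rle_trans (Rabs_triang _ _) _; rewrite !Rabs_mult.
change (size (i :: r)) with (size r).+1; rewrite S_INR /=.
have h1 : Rabs (F i) * Rabs (a - b) <= G * (INR (size r) * G ^ size r * e).
  by apply: Rmult_le_compat => //; exact: Rabs_pos.
have h2 : Rabs (F i - H i) * Rabs b <= e * G ^ size r.
  by apply: Rmult_le_compat => //; exact: Rabs_pos.
have h3 := Rmult_le_pos _ _ e0 G0.
nra.
Qed.

Lemma detR_lip p (A B : 'I_p -> 'I_p -> R) :
  (forall a b, Rabs (A a b) <= G) -> (forall a b, Rabs (B a b) <= G) ->
  (forall a b, Rabs (A a b - B a b) <= e) ->
  Rabs (detR A - detR B) <= INR #|{: 'S_p}| * (INR p * G ^ p * e).
Proof.
move=> HA HB HAB; rewrite /detR sumR_sub; apply: Rle_trans (sumR_abs _ _ _) _.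
apply: sumR_le_card => [|s _].
  by apply: Rmult_le_pos => //; apply: Rmult_le_pos; [exact: pos_INR | apply: pow_le; lra].
rewrite -/(sgnR s) -Rmult_minus_distr_l Rabs_mult sgnR_abs Rmult_1_l.
have := @prodR_lip _ (index_enum _) (fun a => A a (s a)) (fun a => B a (s a)).
have -> : size (index_enum 'I_p) = p by rewrite -[RHS]card_ord cardE enumT.
by apply.
Qed.

Lemma detR'_le p (A N : 'I_p -> 'I_p -> R) :
  (forall a b, Rabs (A a b) <= G) -> (forall a b, Rabs (N a b) <= e) ->
  Rabs (detR' A N) <= INR p * (INR #|{: 'S_p}| * (e * G ^ p)).
Proof.
move=> HA HN; have G0 : 0 <= G ^ p by apply: pow_le; lra.
have eG := Rmult_le_pos _ _ e0 G0.
rewrite /detR'; apply: Rle_trans (sumR_abs _ _ _) _; rewrite -[X in INR X * _]card_ord.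
apply: sumR_le_card => [|a _]; first by apply: Rmult_le_pos => //; exact: pos_INR.
rewrite /detR; apply: Rle_trans (sumR_abs _ _ _) _; apply: sumR_le_card => // s _.
rewrite -/(sgnR s) Rabs_mult sgnR_abs Rmult_1_l (bigD1 a) //= eqxx Rabs_mult.
apply: Rmult_le_compat => //; try exact: Rabs_pos.
(* The remaining [p - 1] factors are bounded by [G ^ p], a harmless loss since [1 <= G]. *)
rewrite (eq_bigr (fun j => A j (s j))); last by move=> j /negbTE ->.
rewrite -[X in G ^ X]card_ord cardT enumT.
exact: prodR_le_pow.
Qed.
End DetBounds.

(** * Derivatives along paths *)

Lemma fin_common_radius (I : finType) (P : I -> R -> Prop) :
  (forall i, exists d, 0 < d /\ forall h, Rabs h < d -> P i h) ->
  exists d, 0 < d /\ forall i h, Rabs h < d -> P i h.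
Proof.
move=> H; suff [d [d0 Hd]] : exists d, 0 < d /\ forall i h, i \in enum I -> Rabs h < d -> P i h.
  by exists d; split=> // i h; apply: Hd; rewrite mem_enum.
elim: (enum I) => [|i r [d [d0 Hd]]]; first by exists 1; split; [lra|].
have [d' [d'0 Hd']] := H i.
exists (Rmin d d'); split; first exact: Rmin_glb_lt.
move=> j h; rewrite in_cons => /orP [/eqP ->|jr] hd.
  by apply: Hd'; apply: Rlt_le_trans hd _; exact: Rmin_r.
by apply: Hd => //; apply: Rlt_le_trans hd _; exact: Rmin_l.
Qed.

Lemma derivable_pt_lim_incr (f : R -> R) t l e : derivable_pt_lim f t l -> 0 < e ->
  exists d, 0 < d /\ forall h, Rabs h < d -> Rabs (f (t + h) - f t) <= (Rabs l + e) * Rabs h.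
Proof.
move=> H e0; have [d Hd] := H e e0; exists d; split; first exact: cond_pos.
move=> h hd; case: (Req_dec h 0) => [->|h0].
  by rewrite Rplus_0_r Rminus_diag Rabs_R0; lra.
have -> : f (t + h) - f t = ((f (t + h) - f t) / h - l + l) * h by field.
rewrite Rabs_mult; apply: Rmult_le_compat_r; first exact: Rabs_pos.
by apply: Rle_trans (Rabs_triang _ _) _; have := Hd h h0 hd; lra.
Qed.

Lemma derivable_pt_lim_small (f : R -> R) t :
  (forall e, 0 < e -> exists d, 0 < d /\ forall h, Rabs h < d ->
    Rabs (f (t + h) - f t) <= e * Rabs h) ->
  derivable_pt_lim f t 0.
Proof.
move=> H e e0; have [d [d0 Hd]] := H (e / 2) ltac:(lra); exists (mkposreal d d0) => h h0 hd.
have p := Rabs_pos_lt _ h0.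
rewrite Rminus_0_r Rabs_div //; apply: (Rmult_lt_reg_r (Rabs h)) => //.
have -> : Rabs (f (t + h) - f t) / Rabs h * Rabs h = Rabs (f (t + h) - f t) by field; lra.
by have := Hd h hd; nra.
Qed.

Lemma derivable_pt_lim_le (f : R -> R) t l K : derivable_pt_lim f t l ->
  (exists d, 0 < d /\ forall h, Rabs h < d -> Rabs (f (t + h) - f t) <= K * Rabs h) ->
  Rabs l <= K.
Proof.
move=> H [d [d0 Hd]]; apply: Rle_plus_epsilon => e e0.
have [d' Hd'] := H e e0; have d'0 := cond_pos d'.
pose h := Rmin d d' / 2.
have hm : 0 < Rmin d d' by apply: Rmin_glb_lt.
have h1 := Rmin_l d d'; have h2 := Rmin_r d d'.
have ah : Rabs h = h by apply: Rabs_right; rewrite /h; lra.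
have h0 : 0 < h by rewrite /h; lra.
have := Hd' h ltac:(lra) ltac:(rewrite ah /h; lra).
have := Hd h ltac:(rewrite ah /h; lra).
rewrite ah => A B; have E : Rabs ((f (t + h) - f t) / h) <= K.
  rewrite Rabs_div; last lra.
  rewrite ah; apply: (Rmult_le_reg_r h) => //.
  by have -> : Rabs (f (t + h) - f t) / h * h = Rabs (f (t + h) - f t) by field; lra.
have := Rabs_triang ((f (t + h) - f t) / h) (- ((f (t + h) - f t) / h - l)).
rewrite Rabs_Ropp; have -> : (f (t + h) - f t) / h + - ((f (t + h) - f t) / h - l) = l by ring.
lra.
Qed.

Lemma path_incr n (gam : R -> 'I_n -> R) t (v : 'I_n -> R) :
  (forall b, derivable_pt_lim (fun s => gam s b) t (v b)) ->
  exists W d, 0 < W /\ 0 < d /\ forall h, Rabs h < d ->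
    norm2 (vsub (gam (t + h)) (gam t)) <= W * Rabs h.
Proof.
move=> H; have [d [d0 Hd]] := fin_common_radius (fun b => derivable_pt_lim_incr (H b) Rlt_0_1).
have v0 := norm2_ge0 v; have n0 := pos_INR n.
exists (INR n * (norm2 v + 1) + 1), d; split; [nra | split=> // h hd].
have ph := Rabs_pos h.
apply: Rle_trans (_ : INR n * ((norm2 v + 1) * Rabs h) <= _); last nra.
apply: norm2_le_coord => [|i]; first nra.
by apply: Rle_trans (Hd i h hd) _; apply: Rmult_le_compat_r => //; have := norm2_coord v i; lra.
Qed.

Lemma frechet_chain n (f : ('I_n -> R) -> ('I_n -> R)) (D : 'I_n -> 'I_n -> R)
    (gam : R -> 'I_n -> R) t (v : 'I_n -> R) a :
  frechet f (gam t) D ->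
  (forall b, derivable_pt_lim (fun s => gam s b) t (v b)) ->
  derivable_pt_lim (fun s => f (gam s) a) t (\big[Rplus/0]_(b < n) (D a b * v b)).
Proof.
move=> fD dg.
pose lin s := \big[Rplus/0]_(b < n) (D a b * (gam s b - gam t b)).
have dlin : derivable_pt_lim lin t (\big[Rplus/0]_(b < n) (D a b * v b)).
  apply: derivable_pt_lim_sumR => b _; apply: derivable_pt_lim_scal.
  rewrite -[v b]Rminus_0_r; apply: derivable_pt_lim_minus => //; exact: derivable_pt_lim_const.
have lin0 : lin t = 0 by apply: big1 => b _; ring.
(* The Frechet remainder is used with constant [e / W], where [W] bounds the increments of the path
   by [W * Rabs h]. *)
have drem : derivable_pt_lim (fun s => f (gam s) a - lin s) t 0.
  apply: derivable_pt_lim_small => e e0.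
  have [W [d [W0 [d0 Hd]]]] := path_incr dg.
  have [d' [d'0 Hd']] := fD (e / W) ltac:(exact: Rdiv_lt_0_compat).
  exists (Rmin d (d' / W)); split.
    by apply: Rmin_glb_lt => //; exact: Rdiv_lt_0_compat.
  move=> h hd.
  have h1 : Rabs h < d by apply: Rlt_le_trans hd _; exact: Rmin_l.
  have h2 : Rabs h < d' / W by apply: Rlt_le_trans hd _; exact: Rmin_r.
  have Hn := Hd h h1.
  have lt : norm2 (vsub (gam (t + h)) (gam t)) < d'.
    apply: Rle_lt_trans Hn _; have := Rmult_lt_compat_l _ _ _ W0 h2.
    by have -> : W * (d' / W) = d' by field; lra.
  have := Hd' _ lt.
  set w := (fun a => _); have := norm2_coord w a; rewrite {1}/w => A B.
  rewrite lin0 Rminus_0_r.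
  have -> : f (gam (t + h)) a - lin (t + h) - f (gam t) a =
     f (gam (t + h)) a - f (gam t) a - lin (t + h) by ring.
  apply: Rle_trans A _; apply: Rle_trans B _.
  have -> : e * Rabs h = e / W * (W * Rabs h) by field; lra.
  by apply: Rmult_le_compat_l => //; apply: Rlt_le; exact: Rdiv_lt_0_compat.
have := derivable_pt_lim_plus _ _ _ _ _ drem dlin; rewrite Rplus_0_l.
by apply: derivable_pt_lim_ext => s; rewrite /plus_fct; ring.
Qed.

Lemma derivable_line n (x v : 'I_n -> R) b :
  derivable_pt_lim (fun s => x b + s * v b) 0 (v b).
Proof.
rewrite -[X in derivable_pt_lim _ _ X]Rplus_0_l; apply: derivable_pt_lim_plus;
  first exact: derivable_pt_lim_const.
have := derivable_pt_lim_scal _ (v b) _ _ (derivable_pt_lim_id 0); rewrite Rmult_1_r.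
by apply: derivable_pt_lim_ext => s; rewrite /mult_real_fct /id; ring.
Qed.

Lemma line0 n (x v : 'I_n -> R) : (fun b => x b + 0 * v b) = x.
Proof. by apply: functional_extensionality => b; ring. Qed.

(** Both sums are the derivative at 0 of [f] along the line through [x] with direction [v]. *)
Lemma frechet_uniq n (f : ('I_n -> R) -> ('I_n -> R)) x D D' (v : 'I_n -> R) a :
  frechet f x D -> frechet f x D' ->
  \big[Rplus/0]_(b < n) (D a b * v b) = \big[Rplus/0]_(b < n) (D' a b * v b).
Proof.
rewrite -{1 2}(line0 x v) => H H'.
apply: (uniqueness_limite (fun s => f (fun b => x b + s * v b) a) 0).
  by apply: (@frechet_chain n f D (fun s b => x b + s * v b)) => // b; exact: derivable_line.
by apply: (@frechet_chain n f D' (fun s b => x b + s * v b)) => // b; exact: derivable_line.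
Qed.

Lemma norm2_single n (b : 'I_n) h : norm2 (fun i => if i == b then h else 0) = Rabs h.
Proof.
rewrite norm2E /l2 (bigD1 b) //= eqxx big1 => [|i /negbTE ->]; last by ring.
by rewrite Rplus_0_r -sqrt_Rsqr_abs /Rsqr Rmult_1_r.
Qed.

Lemma frechet_le n (f : ('I_n -> R) -> ('I_n -> R)) x D K :
  frechet f x D ->
  (exists d, 0 < d /\ forall y, norm2 (vsub y x) < d ->
    norm2 (vsub (f y) (f x)) <= K * norm2 (vsub y x)) ->
  forall a b, Rabs (D a b) <= K.
Proof.
move=> fD [d [d0 Hd]] a b.
pose v := fun i : 'I_n => if i == b then 1 else 0.
have E : \big[Rplus/0]_(i < n) (D a i * v i) = D a b.
  rewrite (bigD1 b) //= big1 /v ?eqxx => [|i /negbTE ->]; ring.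
rewrite -(line0 x v) in fD.
have := @frechet_chain n f D (fun s b => x b + s * v b) 0 v a fD (derivable_line x v);
  rewrite E => H.
apply: (derivable_pt_lim_le H); exists d; split=> // h hd.
rewrite line0 Rplus_0_l.
have Ev : norm2 (vsub (fun b0 => x b0 + h * v b0) x) = Rabs h.
  rewrite -(norm2_single b h); apply: (@l2_ext _ xpredT) => i _; rewrite /vsub /v;
    case: ifP => _; ring.
rewrite -Ev; apply: Rle_trans (Hd _ _); last by rewrite Ev.
exact: (norm2_coord (vsub _ _) a).
Qed.

(** A single [K] bounds the values, serves as Lipschitz constant and fixes the radius [/ K] on which
    it is valid. The condition weakens as [K] grows, which is what a compactness argument needs. *)
Definition tame_on_cube q n (g : 'I_q -> ('I_n -> R) -> ('I_n -> R)) (M K : R) : Prop :=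
  1 <= K /\ forall x, (forall i, Rabs (x i) <= M) -> forall j,
    (forall a, Rabs (g j x a) <= K) /\
    forall y, norm2 (vsub y x) < / K -> norm2 (vsub (g j y) (g j x)) <= K * norm2 (vsub y x).

Lemma loc_lip_tame q n (g : 'I_q -> ('I_n -> R) -> ('I_n -> R)) (M : R) :
  (forall j, loc_lip (g j)) -> exists K, tame_on_cube g M K.
Proof.
move=> Hlip.
pose B j x K := 1 <= K /\ (forall a, Rabs (g j x a) <= K) /\
    forall y, norm2 (vsub y x) < / K -> norm2 (vsub (g j y) (g j x)) <= K * norm2 (vsub y x).
have mono j x K K' : K <= K' -> B j x K -> B j x K'.
  move=> KK [K1 [H1 H2]]; split; [lra | split=> [a|y Hy]]; first by have := H1 a; lra.
  have := H2 y; have := norm2_ge0 (vsub y x).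
  have := Rinv_le_contravar K K' ltac:(lra) KK; nra.
have [K HK] : exists K, forall j, forall x, (forall i, Rabs (x i) <= M) -> B j x (K j).
  apply: (functional_choice (fun j K => forall x, (forall i, Rabs (x i) <= M) -> B j x K)) => j.
  apply: locally_bounded_on_cube => [|t]; first exact: mono.
  have [r [L [r0 HL]]] := Hlip j t.
  have n0 := pos_INR n; have N0 := norm2_ge0 (g j t); have L0 := Rabs_pos L.
  have LL := Rle_abs L.
  have ir : 0 < 2 / r by apply: Rdiv_lt_0_compat; lra.
  (* [2 / r] forces [/ K <= r / 2], [Rabs L] is the Lipschitz constant, and the last two terms bound
     the field near [t]. *)
  pose K := 1 + 2 / r + Rabs L + norm2 (g j t) + Rabs L * r.
  have Lr : 0 <= Rabs L * r by apply: Rmult_le_pos; lra.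
  (* A cube of this half-side lies in the Euclidean ball of radius [r / 2]; the other half of [r] is
     left for [y]. *)
  exists (r / (2 * (INR n + 1))), K; split; first by apply: Rdiv_lt_0_compat; lra.
  move=> x Hx.
  have xt : norm2 (vsub x t) <= r / 2.
    apply: Rle_trans (_ : INR n * (r / (2 * (INR n + 1))) <= _).
      apply: norm2_le_coord => [|i]; last by apply: Rlt_le; exact: Hx.
      by apply: Rlt_le; apply: Rdiv_lt_0_compat; lra.
    have -> : INR n * (r / (2 * (INR n + 1))) = r / 2 - r / (2 * (INR n + 1)) by field; lra.
    have : 0 < r / (2 * (INR n + 1)) by apply: Rdiv_lt_0_compat; lra.
    lra.
  have tt : norm2 (vsub t t) < r by rewrite norm2_vsubxx.
  have K2 : / K <= r / 2.
    have -> : r / 2 = / (2 / r) by field; lra.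
    by apply: Rinv_le_contravar => //; rewrite /K; lra.
  have P0 := norm2_ge0 (vsub x t).
  split; [by rewrite /K; lra | split=> [a|y Hy]].
    have h1 := norm2_coord (g j x) a; have h2 := norm2_sub_le (g j x) (g j t).
    have h3 := HL x t ltac:(lra) tt.
    have h4 : L * norm2 (vsub x t) <= Rabs L * r by apply: Rle_trans (Rmult_le_compat_r _ _ _ P0
      LL) _; apply: Rmult_le_compat_l; lra.
    by rewrite /K; lra.
  have yt := norm2_triang y x t.
  apply: Rle_trans (HL y x ltac:(lra) ltac:(lra)) _.
  by apply: Rmult_le_compat_r; [exact: norm2_ge0 | rewrite /K; lra].
exists (1 + \big[Rplus/0]_(j < q) Rabs (K j)); split.
  have : 0 <= \big[Rplus/0]_(j < q) Rabs (K j) by apply: sumR_ge0 => j _; exact: Rabs_pos.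
  lra.
move=> x Hx j; apply: proj2; apply: (mono _ _ (K j)); last exact: HK.
have : Rabs (K j) <= \big[Rplus/0]_(j < q) Rabs (K j).
  exact: (@sumR_term _ xpredT (fun j => Rabs (K j)) j (fun _ _ => Rabs_pos _) isT).
by have := Rle_abs (K j); lra.
Qed.

(* Condition (H) at [z]; it supplies derivatives for each pair [j, k], here one per field. *)
Definition involutive_at q n (g : 'I_q -> ('I_n -> R) -> ('I_n -> R)) (CH : R) (z : 'I_n -> R)
    (D : 'I_q -> 'I_n -> 'I_n -> R) : Prop :=
  (forall j, frechet (g j) z (D j)) /\
  forall j k, exists c : 'I_q -> R, norm2 c <= CH /\ forall a,
    \big[Rplus/0]_(b < n) (D k a b * g j z b) =
    \big[Rplus/0]_(b < n) (D j a b * g k z b) + \big[Rplus/0]_(i < q) (c i * g i z a).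

Lemma involutive_at_condH q n (g : 'I_q -> ('I_n -> R) -> ('I_n -> R)) CH z :
  (forall j k : 'I_q,
      exists Dj Dk, frechet (g j) z Dj /\ frechet (g k) z Dk /\
      exists c : 'I_q -> R, norm2 c <= CH /\
        forall a : 'I_n,
          \big[Rplus/0]_(b < n) (Dk a b * g j z b - Dj a b * g k z b)
          = \big[Rplus/0]_(i < q) (c i * g i z a)) ->
  exists D, involutive_at g CH z D.
Proof.
move=> H.
have [D HD] : exists D : 'I_q -> 'I_n -> 'I_n -> R, forall j, frechet (g j) z (D j).
  apply: (functional_choice (fun j D => frechet (g j) z D)) => j.
  (* The diagonal pair provides one derivative per field; [frechet_uniq] then identifies it with
     those given for the other pairs. *)
  by have [Dj [_ [HDj _]]] := H j j; exists Dj.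
exists D; split=> // j k; have [Dj [Dk [Hj [Hk [c [cC E]]]]]] := H j k.
exists c; split=> // a; rewrite -E -sumR_sub.
by rewrite (frechet_uniq _ a (HD k) Hk) (frechet_uniq _ a (HD j) Hj) Rplus_minus.
Qed.

(** * The derivative of the minors under (H) *)

Definition tuple_upd p m (K : p.-tuple 'I_m) (a : 'I_p) (l : 'I_m) : p.-tuple 'I_m :=
  [tuple if i == a then l else tnth K i | i < p].

Lemma sumR_abs_le n (F : 'I_n -> R) c : 0 <= c -> (forall i, Rabs (F i) <= c) ->
  Rabs (\big[Rplus/0]_(i < n) F i) <= INR n * c.
Proof.
move=> c0 H; apply: Rle_trans (sumR_abs _ _ _) _.
by rewrite -[X in INR X * _]card_ord; apply: sumR_le_card.
Qed.

Lemma Rabs_mult_le x y a b : Rabs x <= a -> Rabs y <= b -> Rabs (x * y) <= a * b.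
Proof. by move=> H1 H2; rewrite Rabs_mult; apply: Rmult_le_compat => //; exact: Rabs_pos. Qed.

Section PointwiseBound.
Variables (q n : nat) (g : 'I_q -> ('I_n -> R) -> ('I_n -> R)) (z : 'I_n -> R).
Variables (p : nat) (I : p.-tuple 'I_q) (K : p.-tuple 'I_n).

Let A (a b : 'I_p) := g (tnth I b) z (tnth K a).
Let Lam := LamNorm g p z.

(** The new row [a] is a combination of rows of the full matrix of the fields, so by linearity each
    determinant is a combination of minors whose index tuple [K] has its entry [a] replaced. *)
Lemma detR'_rows_le (M : 'I_n -> 'I_n -> R) (c : R) : 0 <= c -> (forall a l, Rabs (M a l) <= c) ->
  Rabs (detR' A (fun a b => \big[Rplus/0]_(l < n) (M (tnth K a) l * g (tnth I b) z l))) <=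
    INR p * (INR n * (c * Lam)).
Proof.
move=> c0 H; have L0 : 0 <= Lam := LamNorm_ge0 g p z; have n0 := pos_INR n.
have cL := Rmult_le_pos _ _ c0 L0.
apply: sumR_abs_le => [|a]; first exact: Rmult_le_pos.
rewrite (@eq_detR _ _ (fun a' b => if a' == a then
    \big[Rplus/0]_(l < n) (M (tnth K a) l * g (tnth I b) z l) else A a' b)); last first.
  by move=> a' b; case: eqP => [->|].
rewrite (@detR_row_lin p _ a (M (tnth K a)) (fun l _ b => g (tnth I b) z l)).
apply: sumR_abs_le => // l; apply: Rabs_mult_le => //.
rewrite (@eq_detR _ _ (fun a' b => g (tnth I b) z (tnth (tuple_upd K a l) a'))).
  exact: YIK_le_LamNorm.
by move=> a' b; rewrite tnth_mktuple /A; case: ifP.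
Qed.

Lemma detR'_cols_le (M : 'I_q -> 'I_q -> R) (c : R) : 0 <= c -> (forall k i, Rabs (M k i) <= c) ->
  Rabs (detR' A (fun a b => \big[Rplus/0]_(i < q) (M (tnth I b) i * g i z (tnth K a)))) <=
    INR p * (INR q * (c * Lam)).
Proof.
move=> c0 H; have L0 : 0 <= Lam := LamNorm_ge0 g p z; have n0 := pos_INR q.
have cL := Rmult_le_pos _ _ c0 L0.
rewrite detR'_col; apply: sumR_abs_le => [|b]; first exact: Rmult_le_pos.
rewrite (@eq_detR _ _ (fun a b' => if b' == b then
    \big[Rplus/0]_(i < q) (M (tnth I b) i * g i z (tnth K a)) else A a b')); last first.
  by move=> a b'; case: eqP => [->|].
rewrite (@detR_col_lin p _ b (M (tnth I b)) (fun i a _ => g i z (tnth K a))).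
apply: sumR_abs_le => // i; apply: Rabs_mult_le => //.
rewrite (@eq_detR _ _ (fun a b' => g (tnth (tuple_upd I b i) b') z (tnth K a))).
  exact: YIK_le_LamNorm.
by move=> a b'; rewrite tnth_mktuple /A; case: ifP.
Qed.

(* [D_k g_j] is traded for [D_j g_k], which acts on the rows of the minor,
   plus a combination of the fields, which acts on its columns. *)
Lemma detR'_involutive_le (CH G e : R) (D : 'I_q -> 'I_n -> 'I_n -> R)
    (u : 'I_q -> R) (v : 'I_n -> R) :
  involutive_at g CH z D -> 0 <= CH -> 1 <= G -> 0 <= e ->
  (forall j a l, Rabs (D j a l) <= G) -> (forall j a, Rabs (g j z a) <= G) ->
  (forall j, Rabs (u j) <= 1) ->
  (forall l, Rabs (v l - \big[Rplus/0]_(j < q) (u j * g j z l)) <= e) ->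
  Rabs (detR' A (fun a b => \big[Rplus/0]_(l < n) (D (tnth I b) (tnth K a) l * v l))) <=
    INR q * (INR p * (INR n * G) + INR p * (INR q * CH)) * Lam +
    INR p * (INR #|{: 'S_p}| * (INR n * (G * e) * G ^ p)).
Proof.
move=> [_ inv] CH0 G1 e0 HD Hg Hu Hv.
have L0 : 0 <= Lam := LamNorm_ge0 g p z; have n0 := pos_INR n; have p0 := pos_INR p.
have [c Hc] : exists c : 'I_q * 'I_q -> 'I_q -> R, forall jk, norm2 (c jk) <= CH /\ forall a,
    \big[Rplus/0]_(b < n) (D jk.2 a b * g jk.1 z b) =
    \big[Rplus/0]_(b < n) (D jk.1 a b * g jk.2 z b) + \big[Rplus/0]_(i < q) (c jk i * g i z a).
  apply: (functional_choice (fun jk c => norm2 c <= CH /\ forall a,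
    \big[Rplus/0]_(b < n) (D jk.2 a b * g jk.1 z b) =
    \big[Rplus/0]_(b < n) (D jk.1 a b * g jk.2 z b) + \big[Rplus/0]_(i < q) (c i * g i z a))) => jk.
  exact: inv.
pose N1 j a b := \big[Rplus/0]_(l < n) (D j (tnth K a) l * g (tnth I b) z l).
pose N2 j a b := \big[Rplus/0]_(i < q) (c (j, tnth I b) i * g i z (tnth K a)).
(* The part of [v] that is not the given combination of the fields at [z]. It does not produce
   minors, so it is bounded entrywise and carries no factor [Lam]. *)
pose Er a b := \big[Rplus/0]_(l < n)
  (D (tnth I b) (tnth K a) l * (v l - \big[Rplus/0]_(j < q) (u j * g j z l))).
have -> : detR' A (fun a b => \big[Rplus/0]_(l < n) (D (tnth I b) (tnth K a) l * v l)) =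
    \big[Rplus/0]_(j < q) (u j * (detR' A (N1 j) + detR' A (N2 j))) + detR' A Er.
  rewrite (@eq_detR' _ _ _ (fun a b => \big[Rplus/0]_(j < q) (u j * (N1 j a b + N2 j a b)) + Er a
    b)).
    rewrite detR'_add (@detR'_lin p _ u (fun j a b => N1 j a b + N2 j a b)); congr (_ + _).
    by apply: eq_bigr => j _; rewrite detR'_add.
  move=> a b.
  have -> : \big[Rplus/0]_(j < q) (u j * (N1 j a b + N2 j a b)) =
      \big[Rplus/0]_(l < n) (D (tnth I b) (tnth K a) l * \big[Rplus/0]_(j < q) (u j * g j z l)).
    rewrite (eq_bigr (fun j => \big[Rplus/0]_(l < n) (D (tnth I b) (tnth K a) l * (u j * g j z
      l)))).
      by rewrite exchange_big /=; apply: eq_bigr => l _; rewrite big_distrr.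
    move=> j _; rewrite -(proj2 (Hc (j, tnth I b)) (tnth K a)) big_distrr /=.
    by apply: eq_bigr => l _; ring.
  by rewrite /Er -big_split /=; apply: eq_bigr => l _; ring.
apply: Rle_trans (Rabs_triang _ _) _; apply: Rplus_le_compat; last first.
  have ne : 0 <= INR n * (G * e) by apply: Rmult_le_pos => //; apply: Rmult_le_pos; lra.
  apply: detR'_le => // a b; first exact: Hg.
  rewrite /Er; apply: sumR_abs_le => [|l]; first by apply: Rmult_le_pos; lra.
  exact: Rabs_mult_le.
have G0 : 0 <= G by lra.
have q0 := pos_INR q.
pose B := INR p * (INR n * (G * Lam)) + INR p * (INR q * (CH * Lam)).
have B0 : 0 <= B by apply: Rplus_le_le_0_compat; do !apply: Rmult_le_pos => //.
have -> : INR q * (INR p * (INR n * G) + INR p * (INR q * CH)) * Lam = INR q * (1 * B).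
  by rewrite /B; ring.
apply: sumR_abs_le => [|j]; first by lra.
apply: Rabs_mult_le => //; apply: Rle_trans (Rabs_triang _ _) _; apply: Rplus_le_compat.
  exact: detR'_rows_le.
apply: (@detR'_cols_le (fun k => c (j, k))) => // k i.
by apply: Rle_trans (norm2_coord _ _) _; case: (Hc (j, k)).
Qed.
End PointwiseBound.

Lemma LamDiff_lip q n (g : 'I_q -> ('I_n -> R) -> ('I_n -> R)) p M K : tame_on_cube g M K ->
  exists L, 0 <= L /\ forall x y, (forall i, Rabs (x i) <= M) -> (forall i, Rabs (y i) <= M) ->
    norm2 (vsub y x) < / K -> LamDiff g p y x <= L * norm2 (vsub y x).
Proof.
move=> [K1 tame].
pose N := INR #|{: p.-tuple 'I_q * p.-tuple 'I_n}|.
pose P := INR #|{: 'S_p}| * (INR p * K ^ p * K).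
have P0 : 0 <= P.
  by do !apply: Rmult_le_pos; try exact: pos_INR; try (apply: pow_le; lra); lra.
have N0 : 0 <= N := pos_INR _.
exists (N * P); split; first exact: Rmult_le_pos.
move=> x y Hx Hy Hxy; rewrite LamDiffE Rmult_assoc.
have d0 := norm2_ge0 (vsub y x).
apply: l2_le_card => [|JK _]; first exact: Rmult_le_pos.
have -> : P * norm2 (vsub y x) = INR #|{: 'S_p}| * (INR p * K ^ p * (K * norm2 (vsub y x))).
  by rewrite /P; ring.
apply: detR_lip => //; first by apply: Rmult_le_pos; lra.
- by move=> a b; case: (tame y Hy (tnth JK.1 b)).
- by move=> a b; case: (tame x Hx (tnth JK.1 b)).
move=> a b; apply: Rle_trans (proj2 (tame x Hx (tnth JK.1 b)) y Hxy).
exact: (norm2_coord (vsub _ _)).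
Qed.

(** The Gronwall rate. The cardinal comes from passing from single minors to the Euclidean norm, the
    two inner summands from the row and the column contributions. *)
Definition Crate (q n p : nat) (K CH : R) : R :=
  INR #|{: p.-tuple 'I_q * p.-tuple 'I_n}| *
  (INR q * (INR p * (INR n * K) + INR p * (INR q * CH))).

(** The coefficient of the velocity error; its contribution is not proportional to the norm of
    Lambda_p and disappears only with the translate. *)
Definition Cerr (q n p : nat) (K : R) : R :=
  INR #|{: p.-tuple 'I_q * p.-tuple 'I_n}| *
  (INR p * (INR #|{: 'S_p}| * (INR n * K * K ^ p))).

Lemma LamDiff_rate q n (g : 'I_q -> ('I_n -> R) -> ('I_n -> R)) p M K CH e delta D
    (gam : R -> 'I_n -> R) t (u : 'I_q -> R) (v : 'I_n -> R) :
  tame_on_cube g M K -> (forall i, Rabs (gam t i) <= M) -> 0 <= CH -> 0 <= e -> 0 < delta ->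
  involutive_at g CH (gam t) D ->
  (forall b, derivable_pt_lim (fun s => gam s b) t (v b)) ->
  (forall j, Rabs (u j) <= 1) ->
  (forall l, Rabs (v l - \big[Rplus/0]_(j < q) (u j * g j (gam t) l)) <= e) ->
  exists d, 0 < d /\ forall h, Rabs h < d ->
    LamDiff g p (gam (t + h)) (gam t) <=
      (Crate q n p K CH * LamNorm g p (gam t) + Cerr q n p K * e + delta) * Rabs h.
Proof.
move=> [K1 tame] Hx CH0 e0 delta0 inv dg Hu Hv.
have [fr _] := inv.
have HD j a l : Rabs (D j a l) <= K.
  apply: (frechet_le (fr j)); exists (/ K); split; first by apply: Rinv_0_lt_compat; lra.
  by case: (tame _ Hx j).
have Hg j a : Rabs (g j (gam t) a) <= K by case: (tame _ Hx j).
set N := INR #|{: p.-tuple 'I_q * p.-tuple 'I_n}|.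
have N0 : 0 <= N := pos_INR _.
pose B := INR q * (INR p * (INR n * K) + INR p * (INR q * CH)) * LamNorm g p (gam t) +
    INR p * (INR #|{: 'S_p}| * (INR n * (K * e) * K ^ p)).
(* The slack allowed to each minor, so that all [N] of them together use at most [delta]. *)
have d1 : 0 < delta / (N + 1) by apply: Rdiv_lt_0_compat; lra.
have [d [d0 Hd]] : exists d, 0 < d /\ forall (JK : p.-tuple 'I_q * p.-tuple 'I_n) h, Rabs h < d ->
    Rabs (YIK g JK.1 JK.2 (gam (t + h)) - YIK g JK.1 JK.2 (gam t)) <= (B + delta / (N + 1)) *
      Rabs h.
  apply: (@fin_common_radius _ (fun (JK : p.-tuple 'I_q * p.-tuple 'I_n) h =>
    Rabs (YIK g JK.1 JK.2 (gam (t + h)) - YIK g JK.1 JK.2 (gam t)) <= (B + delta / (N + 1)) *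
      Rabs h)) => JK.
  have dY := @derivable_pt_lim_detR p (fun s a b => g (tnth JK.1 b) (gam s) (tnth JK.2 a))
     (fun a b => \big[Rplus/0]_(l < n) (D (tnth JK.1 b) (tnth JK.2 a) l * v l)) t
     (fun a b => frechet_chain (tnth JK.2 a) (fr (tnth JK.1 b)) dg).
  have [d [d0 Hd]] := derivable_pt_lim_incr dY d1.
  exists d; split=> // h hd; apply: Rle_trans (Hd h hd) _.
  apply: Rmult_le_compat_r; first exact: Rabs_pos.
  apply: Rplus_le_compat_r.
  exact: (detR'_involutive_le JK.1 JK.2 inv CH0 K1 e0 HD Hg Hu Hv).
have B0 : 0 <= B.
  have L0 := LamNorm_ge0 g p (gam t).
  apply: Rplus_le_le_0_compat; do !(apply: Rmult_le_pos || apply: Rplus_le_le_0_compat) => //;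
    try exact: pos_INR; try (apply: pow_le); lra.
exists d; split=> // h hd; have h0 := Rabs_pos h.
rewrite LamDiffE; apply: Rle_trans (_ : N * ((B + delta / (N + 1)) * Rabs h) <= _).
  apply: l2_le_card => [|JK _]; last exact: Hd.
  by apply: Rmult_le_pos; lra.
rewrite -Rmult_assoc; apply: Rmult_le_compat_r => //.
have -> : Crate q n p K CH * LamNorm g p (gam t) + Cerr q n p K * e + delta = N * B + delta.
  by rewrite /Crate /Cerr -/N /B; ring.
have : N * (delta / (N + 1)) = delta - delta / (N + 1) by field; lra.
lra.
Qed.

(** * Gronwall's inequality along subunit paths *)

(** The Lipschitz constant of the path may be large, so the confinement time must come from the
    equation. In [V] below, [INR q * K] bounds each coordinate of the velocity, 1 is slack for
    difference quotients, and [INR n] passes to the Euclidean norm. *)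
Lemma subunit_confined q n (g : 'I_q -> ('I_n -> R) -> ('I_n -> R)) M0 M K T gam t :
  tame_on_cube g M K -> M0 + 1 <= M -> norm2 (gam 0) <= M0 -> subunit g T gam ->
  0 <= t <= T -> INR n * (INR q * K + 1) * t < 1 -> norm2 (vsub (gam t) (gam 0)) < 1.
Proof.
move=> [K1 tame] MM x0 [[L HL] sub] [t0 tT] Vt.
have HL' s r : 0 <= s <= t -> 0 <= r <= t -> norm2 (vsub (gam s) (gam r)) <= Rabs L * Rabs (s - r).
  move=> hs hr; apply: Rle_trans (HL s r ltac:(lra) ltac:(lra)) _.
  by apply: Rmult_le_compat_r; [exact: Rabs_pos | exact: Rle_abs].
have L0 := Rabs_pos L; have n0 := pos_INR n; have q0 := pos_INR q.
set V := INR n * (INR q * K + 1) in Vt *.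
have V0 : 0 <= V by apply: Rmult_le_pos => //; nra.
(* Truncation avoids a circular argument: below 1 the path is in the cube, where the speed bound is
   available, and at 1 [w] cannot grow. *)
pose w s := Rmin 1 (norm2 (vsub (gam s) (gam 0))).
have w0 : w 0 = 0 by rewrite /w norm2_vsubxx Rmin_right; lra.
have wlip s r : w s - w r <= norm2 (vsub (gam s) (gam r)).
  have := norm2_triang (gam s) (gam r) (gam 0); have := norm2_ge0 (vsub (gam s) (gam r)).
  by rewrite /w /Rmin; do 2!case: Rle_dec; lra.
suff : w t <= V * t by rewrite /w /Rmin; case: Rle_dec; lra.
apply: Rle_plus_epsilon => eps eps0.
(* On the exceptional times the path moves at speed at most [Rabs L]; this choice makes their total
   contribution at most [eps]. *)
have eta0 : 0 < eps / (Rabs L + 1) by apply: Rdiv_lt_0_compat; lra.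
have [m [mm [m0 [mT gain]]]] := null1_gain sub t0 eta0.
have Lm : Rabs L * m t <= eps.
  apply: Rle_trans (Rmult_le_compat_l _ _ _ L0 mT) _.
  have : Rabs L * (eps / (Rabs L + 1)) = eps - eps / (Rabs L + 1) by field; lra.
  lra.
suff : w t - w 0 <= (V * t + Rabs L * m t) - (V * 0 + Rabs L * m 0).
  by rewrite w0; have := Rmult_le_pos _ _ L0 m0; lra.
apply: (@right_local_growth w (fun s => V * s + Rabs L * m s)) => //.
- move=> r hr e e0; exists (e / (Rabs L + 1)); split; first by apply: Rdiv_lt_0_compat; lra.
  move=> s hs sr; apply: Rle_lt_trans (_ : Rabs L * Rabs (s - r) < e).
    apply: Rabs_le; have h1 := wlip s r; have h2 := wlip r s.
    by have h3 := HL' s r hs hr; have h4 := HL' r s hr hs; rewrite Rabs_minus_sym in h4; lra.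
  have sr0 := Rabs_pos (s - r).
  apply: Rle_lt_trans (_ : (Rabs L + 1) * Rabs (s - r) < e); first nra.
  have -> : e = (Rabs L + 1) * (e / (Rabs L + 1)) by field; lra.
  by apply: Rmult_lt_compat_l => //; lra.
- move=> r s r0 rs st; have := mm r s r0 rs st; nra.
move=> r [r0 rt].
case: (classic (exists u : 'I_q -> R, norm2 u <= 1 /\
      forall a : 'I_n, derivable_pt_lim (fun s => gam s a) r
                         (\big[Rplus/0]_(j < q) (u j * g j (gam r) a)))) => [[u [u1 du]]|bad];
                           last first.
  have [|d [d0 Hd]] := gain r (conj r0 rt); first by split; [lra|].
  exists d; split=> // s hs st; have h1 := wlip s r.
  have h2 := HL' s r ltac:(lra) ltac:(lra); rewrite (Rabs_right (s - r)) in h2; last lra.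
  by have := Hd s hs st; nra.
case: (Rle_lt_dec 1 (norm2 (vsub (gam r) (gam 0)))) => near.
  exists 1; split; first lra.
  move=> s hs st; have : w s <= 1 by exact: Rmin_l.
  have : w r = 1 by rewrite /w Rmin_left.
  by have := mm r s r0 ltac:(lra) st; nra.
have cube i : Rabs (gam r i) <= M.
  by have := norm2_coord (gam r) i; have := norm2_sub_le (gam r) (gam 0); lra.
have vb a : Rabs (\big[Rplus/0]_(j < q) (u j * g j (gam r) a)) <= INR q * (1 * K).
  apply: sumR_abs_le => [|j]; first lra.
  apply: Rabs_mult_le; first by have := norm2_coord u j; lra.
  by case: (tame _ cube j).
have [d [d0 Hd]] := fin_common_radius (fun a => derivable_pt_lim_incr (du a) Rlt_0_1).
exists d; split=> // s hs st; apply: Rle_trans (wlip s r) _.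
apply: Rle_trans (_ : V * (s - r) <= _); last by have := mm r s r0 ltac:(lra) st; nra.
rewrite /V Rmult_assoc; apply: norm2_le_coord => [|a]; first by apply: Rmult_le_pos; nra.
have sr : Rabs (s - r) = s - r by apply: Rabs_right; lra.
have := Hd a (s - r) ltac:(rewrite sr; lra); rewrite sr /vsub.
have -> : r + (s - r) = s by ring.
move=> H; apply: Rle_trans H _; apply: Rmult_le_compat_r; first lra.
by have := vb a; lra.
Qed.

(** One finite step of the integrating factor: the growth factor 1 + C (s - t) is absorbed by exp (C
    (s - t)), and the error survives because exp (- C s) is at most 1. *)
Lemma gronwall_step C A f f' t s delta : 0 <= C -> 0 <= t -> t <= s -> 0 <= f + A -> 0 <= delta ->
  f' - f <= (C * (f + A) + delta) * (s - t) ->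
  exp (- C * s) * (f' + A) - exp (- C * t) * (f + A) <= delta * (s - t).
Proof.
move=> C0 t0 ts fA d0 H.
have e1 : exp (- C * t) = exp (- C * s) * exp (C * (s - t)) by rewrite -exp_plus; congr exp; ring.
have e2 : 1 + C * (s - t) <= exp (C * (s - t)) by exact: exp_ineq1_le.
have e3 := exp_pos (- C * s).
have e4 : exp (- C * s) <= 1.
  rewrite -exp_0; case: (Rle_lt_or_eq_dec (- C * s) 0) => [|lt|->]; [nra | | lra].
  by apply: Rlt_le; exact: exp_increasing.
rewrite e1.
have h1 : exp (- C * s) * (f' - f - C * (s - t) * (f + A)) <= exp (- C * s) * (delta * (s - t)).
  by apply: Rmult_le_compat_l; lra.
have h2 : exp (- C * s) * (delta * (s - t)) <= 1 * (delta * (s - t)).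
  by apply: Rmult_le_compat_r => //; apply: Rmult_le_pos; lra.
have h3 : exp (- C * s) * (f + A) * (1 + C * (s - t)) <= exp (- C * s) * (f + A) * exp (C * (s -
  t)).
  by apply: Rmult_le_compat_l => //; apply: Rmult_le_pos; lra.
lra.
Qed.

(** A subunit path is constrained on its time interval only; composing with this 1-Lipschitz
    retraction makes it continuous on the whole line, as the integral lemmas require. *)
Definition clamp (T s : R) : R := Rmax 0 (Rmin T s).

Lemma clamp_in T s : 0 <= T -> 0 <= clamp T s <= T.
Proof. by move=> T0; rewrite /clamp /Rmax /Rmin; do 2!case: Rle_dec; lra. Qed.

Lemma clamp_id T s : 0 <= s <= T -> clamp T s = s.
Proof. by move=> sT; rewrite /clamp /Rmax /Rmin; do 2!case: Rle_dec; lra. Qed.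

Lemma clamp_lip T s r : Rabs (clamp T s - clamp T r) <= Rabs (s - r).
Proof.
rewrite /clamp /Rmin; case: (Rle_dec T s) => ?; case: (Rle_dec T r) => ?; rewrite /Rmax.
all: by do !case: Rle_dec => ?; rewrite /Rabs; do !case: Rcase_abs => ?; lra.
Qed.

(** * Gronwall's inequality along a translated path *)

Section Perturbation.
Variables (q n : nat) (g : 'I_q -> ('I_n -> R) -> ('I_n -> R)) (p : nat).
Variables (M0 K CH C T t1 : R) (gam : R -> 'I_n -> R).
Hypotheses (n0 : (0 < n)%nat) (CH0 : 0 <= CH) (C1 : 1 <= C) (CC : Crate q n p K CH <= C).
Hypothesis tame : tame_on_cube g (M0 + 2) K.
Hypothesis HN : null_set (fun z => norm2 z < M0 + 3 /\ ~ exists D, involutive_at g CH z D).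
Hypothesis sub : subunit g T gam.
Hypothesis t1T : 0 <= t1 <= T.
Hypothesis x0 : norm2 (gam 0) <= M0.
Hypothesis conf : forall s, 0 <= s <= t1 -> norm2 (vsub (gam s) (gam 0)) < 1.

(** [Z] may depend on the path, as it is multiplied by [kappa], which later tends to 0. The radii
    are nested: the path stays within [M0 + 1], its translate within [M0 + 2], and hence strictly
    inside the ball of radius [M0 + 3] on which the failure of (H) is null. *)
Lemma LamDiff_perturbed : exists Z kap0, 0 < kap0 /\ forall kappa, 0 < kappa < kap0 ->
  LamDiff g p (gam t1) (gam 0) <= LamNorm g p (gam 0) * (exp (C * t1) - 1) + Z * kappa.
Proof.
have [[Lg HLg] subae] := sub; have [K1 tameK] := tame.
have [L [L0 HL]] := LamDiff_lip p tame.
have in0 := pos_INR n; have q0 := pos_INR q.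
have iK : 0 < / K by apply: Rinv_0_lt_compat; lra.
have iK1 : / K <= 1 by rewrite -Rinv_1; apply: Rinv_le_contravar; lra.
have n1 : 1 <= INR n by rewrite -INR_1; apply: le_INR; apply/leP.
have Ce0 : 0 <= Cerr q n p K.
  by rewrite /Cerr; do !apply: Rmult_le_pos => //; try exact: pos_INR; try apply: pow_le; lra.
have Lg0 := Rabs_pos Lg.
have HLg' s r : 0 <= s <= t1 -> 0 <= r <= t1 -> norm2 (vsub (gam s) (gam r)) <= Rabs Lg * Rabs (s
  - r).
  move=> hs hr; apply: Rle_trans (HLg s r ltac:(lra) ltac:(lra)) _.
  by apply: Rmult_le_compat_r; [exact: Rabs_pos | exact: Rle_abs].
have E1 : 1 <= exp (C * t1) by have := exp_ineq1_le (C * t1); nra.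
pose L' := L * Rabs Lg.
have L'0 : 0 <= L' by apply: Rmult_le_pos.
pose ce := Cerr q n p K * (INR q * (1 * (K * INR n))).
(* In order: the errors accumulated in Gronwall's inequality, the return from the translate at both
   endpoints, and the comparison of the initial term [A] with the norm at [gam 0]. *)
exists (exp (C * t1) * (t1 + 2 * L') + 2 * L * INR n + (L * INR n + ce) * (exp (C * t1) - 1)).
(* This keeps the norm of the translate below [/ K], the radius of the Lipschitz estimates, and so
   below 1. *)
exists (/ K / INR n); split; first by apply: Rdiv_lt_0_compat; lra.
move=> kap [kap0 kap1].
have nk : INR n * kap < / K.
  have := Rmult_lt_compat_l _ _ _ (Rlt_le_trans _ _ _ Rlt_0_1 n1) kap1.
  by have -> : INR n * (/ K / INR n) = / K by field; lra.
have cg i : continuity (fun s => gam (clamp t1 s) i).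
  move=> r e e0; exists (e / (Rabs Lg + 1)); split; first by apply: Rdiv_lt_0_compat; lra.
  move=> s [_ sr]; rewrite /= /R_dist in sr *.
  have h1 := norm2_coord (vsub (gam (clamp t1 s)) (gam (clamp t1 r))) i.
  have h2 := HLg' _ _ (clamp_in s (proj1 t1T)) (clamp_in r (proj1 t1T)).
  have h3 := clamp_lip t1 s r.
  apply: Rle_lt_trans h1 _; apply: Rle_lt_trans h2 _.
  apply: Rle_lt_trans (_ : (Rabs Lg + 1) * Rabs (s - r) < e).
    by have := Rabs_pos (clamp t1 s - clamp t1 r); nra.
  have -> : e = (Rabs Lg + 1) * (e / (Rabs Lg + 1)) by field; lra.
  by apply: Rmult_lt_compat_l => //; lra.
(* Here [m] is the clock for the failure of (H) at the translate and [m'] below that for the missing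
   derivative; both totals are at most [kap], so that all errors are of order [kap]. *)
have [y [m [y0 [mm [m0 [mT gain]]]]]] := null_set_gain n0 HN cg (proj1 t1T) kap0 kap0.
have [m' [mm' [m'0 [m'T gain']]]] := null1_gain subae (proj1 t1T) kap0.
have ny : norm2 y <= INR n * kap.
  by apply: norm2_le_coord => [|i]; [lra | rewrite Rabs_right; have := y0 i; lra].
pose gy s i := y i + gam s i.
have gysub s r : norm2 (vsub (gy s) (gy r)) = norm2 (vsub (gam s) (gam r)).
  by apply: (@l2_ext _ xpredT) => i _; rewrite /vsub /gy; ring.
have gyg s : norm2 (vsub (gy s) (gam s)) = norm2 y.
  by apply: (@l2_ext _ xpredT) => i _; rewrite /vsub /gy; ring.
have ngam s : 0 <= s <= t1 -> norm2 (gam s) <= M0 + 1.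
  by move=> hs; have := conf hs; have := norm2_sub_le (gam s) (gam 0); lra.
have ngy s : 0 <= s <= t1 -> norm2 (gy s) <= M0 + 2.
  by move=> hs; have := ngam s hs; have := norm2_sub_le (gy s) (gam s); rewrite gyg; lra.
have cgam s : 0 <= s <= t1 -> forall i, Rabs (gam s i) <= M0 + 2.
  by move=> hs i; have := ngam s hs; have := norm2_coord (gam s) i; lra.
have cgy s : 0 <= s <= t1 -> forall i, Rabs (gy s i) <= M0 + 2.
  by move=> hs i; have := ngy s hs; have := norm2_coord (gy s) i; lra.
have t10 : 0 <= 0 <= t1 by lra.
have t11 : 0 <= t1 <= t1 by lra.
pose phi s := LamDiff g p (gy s) (gy 0).
have phi0 s : 0 <= phi s by exact: LamDiff_ge0.
have phi00 : phi 0 = 0.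
  rewrite /phi LamDiffE /l2 big1 ?sqrt_0 // => JK _; ring.
have Lam0 := LamNorm_ge0 g p (gy 0).
pose e := INR q * (1 * (K * norm2 y)).
have e0 : 0 <= e.
  by apply: Rmult_le_pos => //; rewrite Rmult_1_l; apply: Rmult_le_pos; [lra | exact: norm2_ge0].
(* The norm at [gy t] is at most [phi t] plus the norm at [gy 0], and [1 <= C] lets [C] also
   multiply the velocity error: the rate becomes [C * (phi t + A) + kap]. *)
pose A := LamNorm g p (gy 0) + Cerr q n p K * e.
have A0 : 0 <= A by apply: Rplus_le_le_0_compat => //; exact: Rmult_le_pos.
have lipgy s r : 0 <= s <= t1 -> 0 <= r <= t1 -> Rabs Lg * Rabs (s - r) < / K ->
    LamDiff g p (gy s) (gy r) <= L' * Rabs (s - r).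
  move=> hs hr sr; have h1 := HLg' s r hs hr.
  apply: Rle_trans (HL (gy r) (gy s) (cgy r hr) (cgy s hs) _) _; first by rewrite gysub; lra.
  by rewrite gysub /L' Rmult_assoc; apply: Rmult_le_compat_l.
have lipphi s r : phi s - phi r <= LamDiff g p (gy s) (gy r).
  by have := LamDiff_triang g p (gy s) (gy r) (gy 0); rewrite /phi; lra.
pose d1 := / K / (Rabs Lg + 1).
have d10 : 0 < d1 by apply: Rdiv_lt_0_compat; lra.
have d1K z : Rabs z < d1 -> Rabs Lg * Rabs z < / K.
  move=> zd; apply: Rle_lt_trans (_ : (Rabs Lg + 1) * Rabs z < _); first by have := Rabs_pos z; nra.
  have -> : / K = (Rabs Lg + 1) * d1 by rewrite /d1; field; lra.
  by apply: Rmult_lt_compat_l => //; lra.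
pose w s := exp (- C * s) * (phi s + A).
(* The error budget: [kap] is the slack of the derivative at good times, and [L'] times the clocks
   covers the Lipschitz growth at bad ones. *)
pose mu s := kap * s + L' * (m s + m' s).
have growth : w t1 - w 0 <= mu t1 - mu 0.
  apply: right_local_growth; first lra.
  - have cphi : continuity (fun s => phi (clamp t1 s)).
      move=> r eps eps0; exists (Rmin d1 (eps / (L' + 1))); split.
        by apply: Rmin_glb_lt => //; apply: Rdiv_lt_0_compat; lra.
      move=> s [_ sr]; rewrite /= /R_dist in sr *.
      have s1 : Rabs (s - r) < d1 by apply: Rlt_le_trans sr _; exact: Rmin_l.
      have s2 : Rabs (s - r) < eps / (L' + 1) by apply: Rlt_le_trans sr _; exact: Rmin_r.
      have cl := clamp_lip t1 s r.
      have cs := clamp_in s (proj1 t1T); have cr := clamp_in r (proj1 t1T).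
      apply: Rle_lt_trans (_ : L' * Rabs (s - r) < eps).
        apply: Rle_trans (Rmult_le_compat_l _ _ _ L'0 cl).
        have h1 := lipgy _ _ cs cr (d1K _ (Rle_lt_trans _ _ _ cl s1)).
        apply: Rabs_le; have := lipphi (clamp t1 s) (clamp t1 r).
        by have := lipphi (clamp t1 r) (clamp t1 s); rewrite (LamDiffC _ _ (gy (clamp t1 r))); lra.
      apply: Rle_lt_trans (_ : (L' + 1) * Rabs (s - r) < _); first by have := Rabs_pos (s - r); nra.
      have -> : eps = (L' + 1) * (eps / (L' + 1)) by field; lra.
      by apply: Rmult_lt_compat_l => //; lra.
    have cw : continuity (fun s => exp (- C * s) * (phi (clamp t1 s) + A)).
      move=> s; apply: continuity_pt_mult.
        by apply: derivable_continuous_pt; apply: ex_derive_Reals_0; auto_derive.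
      by apply: continuity_pt_plus; [exact: cphi | exact: continuity_pt_const].
    move=> t ht eps eps0; have [d [d0 Hd]] := cw t eps eps0; exists d; split=> // s hs st.
    case: (Req_dec t s) => [->|ts]; first by rewrite Rminus_diag Rabs_R0.
    have := Hd s (conj (conj Logic.I ts) st).
    by rewrite /= /R_dist !clamp_id.
  - move=> t s t0 ts st; have := mm t s t0 ts st; have := mm' t s t0 ts st.
    by move=> h1 h2; rewrite /mu; apply: Rplus_le_compat; apply: Rmult_le_compat_l; lra.
  move=> t [t0 tt1]; have ht : 0 <= t <= t1 by lra.
  have muge s : t < s -> s <= t1 -> kap * (s - t) <= mu s - mu t /\
      L' * (m s - m t) <= mu s - mu t /\ L' * (m' s - m' t) <= mu s - mu t.
    move=> ts st; have h1 := mm t s t0 (Rlt_le _ _ ts) st; have h2 := mm' t s t0 (Rlt_le _ _ ts) st.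
    have h3 : 0 <= L' * (m s - m t) by apply: Rmult_le_pos; lra.
    have h4 : 0 <= L' * (m' s - m' t) by apply: Rmult_le_pos; lra.
    have h5 : 0 <= kap * (s - t) by apply: Rmult_le_pos; lra.
    by rewrite /mu; lra.
  have fA : 0 <= phi t + A by have := phi0 t; lra.
  have CfA : 0 <= C * (phi t + A) by apply: Rmult_le_pos; lra.
  have crude s : t < s -> s <= t1 -> s < t + d1 -> w s - w t <= L' * (s - t).
    move=> ts st sd; apply: gronwall_step => //; try lra.
    have sr : Rabs (s - t) = s - t by apply: Rabs_right; lra.
    have := lipgy s t ltac:(lra) ht (d1K (s - t) ltac:(rewrite sr; lra)); have := lipphi s t.
    by rewrite sr; nra.
  have bad m2 : right_gain m2 t1 t -> (forall s, t < s -> s <= t1 ->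
    L' * (m2 s - m2 t) <= mu s - mu t) ->
     exists d, 0 < d /\ forall s, t < s < t + d -> s <= t1 -> w s - w t <= mu s - mu t.
    move=> [d [d0 Hd]] Hm; exists (Rmin d d1); split; first exact: Rmin_glb_lt.
    have h1 := Rmin_l d d1; have h2 := Rmin_r d d1.
    move=> s hs st; have := crude s ltac:(lra) st ltac:(lra); have := Hm s ltac:(lra) st.
    by have := Hd s ltac:(lra) st; nra.
  case: (classic (exists u : 'I_q -> R, norm2 u <= 1 /\
      forall a : 'I_n, derivable_pt_lim (fun s => gam s a) t
                         (\big[Rplus/0]_(j < q) (u j * g j (gam t) a)))) => [[u [u1 du]]|ex];
                           last first.
    apply: (bad m'); last by move=> s ts st; case: (muge s ts st) => _ [].
    by apply: gain'; [lra | split; [lra|]].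
  (* (H) is tested on the translate, whereas the subunit equation holds on [gam]; the two
     exceptional sets are independent. *)
  case: (classic (exists D, involutive_at g CH (gy t) D)) => [[D inv]|ex]; last first.
    apply: (bad m); last by move=> s ts st; case: (muge s ts st) => _ [].
    apply: gain => //; rewrite clamp_id //; split=> //.
    by have := ngy t ht; rewrite -/(gy t); lra.
  have dgy b : derivable_pt_lim (fun s => gy s b) t (\big[Rplus/0]_(j < q) (u j * g j (gam t) b)).
    rewrite -[X in derivable_pt_lim _ _ X]Rplus_0_l; apply: derivable_pt_lim_plus => //.
    exact: derivable_pt_lim_const.
  have Hu j : Rabs (u j) <= 1 by have := norm2_coord u j; lra.
  (* The translate has the velocity of [gam], that is, the fields taken at [gam t] rather than at
     [gy t]; the Lipschitz bound makes the discrepancy at most [e]. *)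
  have Hv l : Rabs (\big[Rplus/0]_(j < q) (u j * g j (gam t) l) -
       \big[Rplus/0]_(j < q) (u j * g j (gy t) l)) <= e.
    rewrite sumR_sub; apply: sumR_abs_le => [|j].
      by rewrite Rmult_1_l; apply: Rmult_le_pos; [lra | exact: norm2_ge0].
    rewrite -Rmult_minus_distr_l; apply: Rabs_mult_le => //.
    rewrite Rabs_minus_sym; apply: Rle_trans (norm2_coord (vsub (g j (gy t)) (g j (gam t))) l) _.
    by rewrite -(gyg t); apply: (proj2 (tameK _ (cgam t ht) j)); rewrite gyg; lra.
  have [d [d0 Hd]] := LamDiff_rate p tame (cgy t ht) CH0 e0 kap0 inv dgy Hu Hv.
  exists d; split=> // s hs st.
  apply: Rle_trans (proj1 (muge s (proj1 hs) st)).
  apply: gronwall_step => //; try lra.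
  have sr : Rabs (s - t) = s - t by apply: Rabs_right; lra.
  have := Hd (s - t) ltac:(rewrite sr; lra); rewrite sr.
  have -> : t + (s - t) = s by ring.
  move=> h1; apply: Rle_trans (lipphi s t) _; apply: Rle_trans h1 _.
  apply: Rmult_le_compat_r; first lra.
  have h2 := LamNorm_le g p (gy 0) (gy t); have h3 := LamNorm_ge0 g p (gy t).
  rewrite -/(phi t) in h2.
  have h4 : Crate q n p K CH * LamNorm g p (gy t) <= C * (phi t + LamNorm g p (gy 0)).
    apply: Rle_trans (Rmult_le_compat_r _ _ _ h3 CC) _; apply: Rmult_le_compat_l; lra.
  have h5 := Rmult_le_pos _ _ Ce0 e0.
  by rewrite /A; nra.
have muT : mu t1 - mu 0 <= kap * (t1 + 2 * L').
  have h1 := Rmult_le_compat_l _ _ _ L'0 mT; have h2 := Rmult_le_compat_l _ _ _ L'0 m'T.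
  have h3 := Rmult_le_pos _ _ L'0 m0; have h4 := Rmult_le_pos _ _ L'0 m'0.
  by rewrite /mu; lra.
have w0E : w 0 = A by rewrite /w Rmult_0_r exp_0 phi00; ring.
have wt : phi t1 + A <= exp (C * t1) * (A + kap * (t1 + 2 * L')).
  have -> : phi t1 + A = exp (C * t1) * w t1.
    by rewrite /w -Rmult_assoc -exp_plus (_ : C * t1 + - C * t1 = 0) ?exp_0; ring.
  by apply: Rmult_le_compat_l; [lra | lra].
have near s : 0 <= s <= t1 -> LamDiff g p (gy s) (gam s) <= L * (INR n * kap).
  move=> hs; apply: Rle_trans (HL (gam s) (gy s) (cgam s hs) (cgy s hs) _) _; rewrite gyg;
    first lra.
  exact: Rmult_le_compat_l.
have tri : LamDiff g p (gam t1) (gam 0) <= phi t1 + 2 * (L * (INR n * kap)).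
  have h1 := near t1 t11; have h2 := near 0 t10.
  have h3 := LamDiff_triang g p (gam t1) (gy t1) (gam 0).
  have h4 := LamDiff_triang g p (gy t1) (gy 0) (gam 0).
  by rewrite (LamDiffC _ _ (gam t1) (gy t1)) in h3; rewrite /phi; lra.
have Ale : A <= LamNorm g p (gam 0) + (L * INR n + ce) * kap.
  have h1 := LamNorm_le g p (gam 0) (gy 0); have h2 := near 0 t10.
  have h3 : Cerr q n p K * e <= ce * kap.
    have -> : ce * kap = Cerr q n p K * (INR q * (1 * (K * (INR n * kap)))) by rewrite /ce; ring.
    by do 4!(apply: Rmult_le_compat_l; first lra).
  by rewrite /A; lra.
have := Rmult_le_compat_r (exp (C * t1) - 1) _ _ ltac:(lra) Ale.
lra.
Qed.
End Perturbation.

(** * Choice of the constant and limit of small translates *)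

Lemma null_set_sub n (N N' : ('I_n -> R) -> Prop) : null_set N ->
  (forall x, N' x -> N x) -> null_set N'.
Proof.
move=> HN sub e e0; have [a [b [ab [cov vol]]]] := HN e e0.
by exists a, b; do !split=> //; move=> x /sub; exact: cov.
Qed.

Lemma is_bounded_ball n (r : R) : is_bounded (fun z : 'I_n -> R => norm2 z < r).
Proof. by exists r => z; lra. Qed.

Lemma is_open_ball n (r : R) : is_open (fun z : 'I_n -> R => norm2 z < r).
Proof.
move=> x xr; exists (r - norm2 x); split; first lra.
by move=> y; have := norm2_sub_le y x; lra.
Qed.

Theorem theorem2p3 (q n : nat) (g : 'I_q -> ('I_n -> R) -> ('I_n -> R))
  (Hlip : forall j : 'I_q, loc_lip (g j)) (HH : condH g)
  (Om : ('I_n -> R) -> Prop) (Hbd : is_bounded Om) :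
  exists C : R, 0 < C /\
    forall (x : 'I_n -> R) (T : R) (gam : R -> 'I_n -> R),
      Om x -> subunit g T gam -> gam 0 = x ->
      forall p : nat, leq 1 p -> leq p (minn q n) ->
      forall t : R, 0 <= t <= Rmin T (/ C) ->
        LamDiff g p (gam t) x <= LamNorm g p x * (exp (C * t) - 1) /\
        (forall I : p.-tuple 'I_q, incr_idx I ->
           YIDiff g I (gam t) x <= C * LamNorm g p x * (exp (C * t) - 1)).
Proof.
have [M HM] := Hbd.
pose M0 := Rabs M.
have [K tame] := loc_lip_tame (M0 + 2) Hlip.
have [CH' HN'] := HH (fun z => norm2 z < M0 + 3) (@is_open_ball n _) (@is_bounded_ball n _).
pose CH := Rabs CH'.
have HN : null_set (fun z => norm2 z < M0 + 3 /\ ~ exists D, involutive_at g CH z D).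
  apply: (null_set_sub HN') => z [nz bad]; split=> // H; apply: bad; apply: involutive_at_condH.
  move=> j k; have [Dj [Dk [H1 [H2 [c [H3 H4]]]]]] := H j k.
  exists Dj, Dk; do !split=> //; exists c; split=> //.
  by apply: Rle_trans H3 _; exact: Rle_abs.
have K1 : 1 <= K by case: tame.
have n0 := pos_INR n; have q0 := pos_INR q.
(* Summing over all [p <= q] makes the constant independent of [p]. *)
pose S := \big[Rplus/0]_(p < q.+1) Rabs (Crate q n p K CH).
have S0 : 0 <= S by apply: sumR_ge0 => p _; exact: Rabs_pos.
pose V := INR n * (INR q * K + 1).
have V0 : 0 <= V by apply: Rmult_le_pos => //; nra.
(* [S] dominates the Gronwall rate. [V] confines the path to a unit ball up to time [/ C], the
   summand 1 making that inequality strict; it also gives [1 <= C]. *)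
pose C := 1 + V + S.
have C1 : 1 <= C by rewrite /C; lra.
exists C; split; first lra.
move=> x T gam Ox sub gx p p1 pqn t [t0 tm].
have tT : t <= T by apply: Rle_trans tm _; exact: Rmin_l.
have tC : C * t <= 1.
  have := Rmult_le_compat_l C _ _ ltac:(lra) (Rle_trans _ _ _ tm (Rmin_r _ _)).
  by rewrite Rinv_r; lra.
have n_gt0 : (0 < n)%nat by apply: leq_trans p1 _; apply: leq_trans pqn _; exact: geq_minr.
have pq : (p < q.+1)%nat by rewrite ltnS; apply: leq_trans pqn _; exact: geq_minl.
have CC : Crate q n p K CH <= C.
  apply: Rle_trans (Rle_abs _) _; apply: Rle_trans (_ : S <= C); last by rewrite /C; lra.
  exact: (@sumR_term _ xpredT (fun p : 'I_q.+1 => Rabs (Crate q n p K CH)) (Ordinal pq) (fun _ _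
    => Rabs_pos _) isT).
have x0 : norm2 (gam 0) <= M0 by rewrite gx; apply: Rle_trans (HM _ Ox) _; exact: Rle_abs.
have conf s : 0 <= s <= t -> norm2 (vsub (gam s) (gam 0)) < 1.
  move=> hs; apply: (subunit_confined tame _ x0 sub); [lra | lra | rewrite -/V].
  case: (Req_dec s 0) => [->|s0]; first lra.
  have : V * s <= (C - 1) * s by apply: Rmult_le_compat_r; rewrite /C; lra.
  have : C * s <= C * t by apply: Rmult_le_compat_l; lra.
  lra.
have main : LamDiff g p (gam t) x <= LamNorm g p x * (exp (C * t) - 1).
  have [Z [k0 [k00 HZ]]] := LamDiff_perturbed n_gt0 (Rabs_pos _ : 0 <= CH) C1 CC tame HN sub
    (conj t0 tT) x0 conf.
  rewrite -gx; apply: Rle_plus_epsilon => eps eps0.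
  have Z0 := Rabs_pos Z; have Z1 := Rle_abs Z.
  (* Small enough for the perturbed estimate, and with [Z * k <= eps]. *)
  pose k := Rmin (k0 / 2) (eps / (Rabs Z + 1)).
  have ez : 0 < eps / (Rabs Z + 1) by apply: Rdiv_lt_0_compat; lra.
  have kp : 0 < k by apply: Rmin_glb_lt; lra.
  have kk : k <= k0 / 2 by exact: Rmin_l.
  have ke : k <= eps / (Rabs Z + 1) by exact: Rmin_r.
  have h := HZ k ltac:(lra).
  have h1 : Z * k <= (Rabs Z + 1) * (eps / (Rabs Z + 1)).
    apply: Rle_trans (_ : (Rabs Z + 1) * k <= _); first by apply: Rmult_le_compat_r; lra.
    by apply: Rmult_le_compat_l; lra.
  have h2 : (Rabs Z + 1) * (eps / (Rabs Z + 1)) = eps by field; lra.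
  lra.
(* A single [I] contributes part of the sum defining [LamDiff], and the extra factor [C] is at least
   1. *)
split=> // I HI; apply: Rle_trans (YIDiff_le_LamDiff _ _ _ HI) _.
apply: Rle_trans main _; rewrite Rmult_assoc -[X in X <= _]Rmult_1_l.
apply: Rmult_le_compat_r => //; apply: Rmult_le_pos; first exact: LamNorm_ge0.
have : 0 <= C * t by apply: Rmult_le_pos; lra.
by have := exp_ineq1_le (C * t); lra.
Qed.
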